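(* For $D>0$ let $\lambda(NF/NF)$, $\lambda(NF/FF)$ and $\lambda(NF/H)$ denote the principal eigenvalues of the equation $$-D\phi_{xx}-q(x)\phi_x-r(x)\phi=\lambda\phi,\qquad 0<x<1,$$ under, respectively, the boundary conditions $$\text{(NF/NF)}\ \ \phi_x(0)=\phi_x(1)=0;\qquad \text{(NF/FF)}\ \ \phi_x(0)=\phi_x(1)+\tfrac{q(1)}{D}\phi(1)=0;\qquad \text{(NF/H)}\ \ \phi_x(0)=\phi(1)=0.$$ Then the following hold. (1) If $q>0$ on $[0,1]$, then $$\lim_{D\to0}\lambda(NF/NF)=-r(1),\qquad \lim_{D\to0}\lambda(NF/FF)=\lim_{D\to0}\lambda(NF/H)=\infty.$$ (2) If $q=0$ on $[0,x_0]$ for some $0<x_0<1$ and $q>0$ on $(x_0,1]$, then $$\lim_{D\to0}\lambda(NF/NF)=\min\Big\{\min_{x\in[0,x_0]}(-r(x)),\,-r(1)\Big\},$$ $$\lim_{D\to0}\lambda(NF/FF)=\lim_{D\to0}\lambda(NF/H)=\min_{x\in[0,x_0]}(-r(x)).$$ (3) If $q=0$ on $[x_1,x_2]$ for some $0<x_1<x_2<1$ and $q>0$ on $[0,x_1)\cup(x_2,1]$, then $$\lim_{D\to0}\lambda(NF/NF)=\min\Big\{-r(1),\,\min_{x\in[x_1,x_2]}(-r(x))\Big\},$$ $$\lim_{D\to0}\lambda(NF/FF)=\lim_{D\to0}\lambda(NF/H)=\min_{x\in[x_1,x_2]}(-r(x)).$$ (4) If $q=0$ on $[x_0,1]$ for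 some $0<x_0<1$ and $q>0$ on $[0,x_0)$, then $$\lim_{D\to0}\lambda(NF/NF)=\lim_{D\to0}\lambda(NF/FF)=\lim_{D\to0}\lambda(NF/H)=\min_{x\in[x_0,1]}(-r(x)).$$
   Context: $r\in C([0,1])$ is a real-valued function and $q\in C^1([0,1])$ is nonnegative. The principal eigenvalue is the smallest eigenvalue; it is the one corresponding to an eigenfunction that is positive in $(0,1)$. *)

(* Defs.v *)
From Stdlib Require Import Reals ClassicalEpsilon.
From Coquelicot Require Import Coquelicot.
Open Scope R_scope.

Definition I01 (x : R) : Prop := 0 <= x <= 1.

(* Functions on [0,1] are represented by total functions R -> R.  Continuity
   and differentiability are relative to [0,1], so values outside [0,1] are
   irrelevant and derivatives at 0 and 1 are one-sided. *)
Definition C0_01 (f : R -> R) : Prop :=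
  forall x, I01 x -> continue_in f I01 x.

Definition deriv_01 (f df : R -> R) : Prop :=
  forall x, I01 x -> D_in f df I01 x.

Definition C1_01 (f : R -> R) : Prop :=
  exists df, deriv_01 f df /\ C0_01 df.

Inductive boundary_condition : Set := NF_NF | NF_FF | NF_H.

Definition satisfies_bc (D : R) (q : R -> R) (bc : boundary_condition)
    (phi dphi : R -> R) : Prop :=
  match bc with
  | NF_NF => dphi 0 = 0 /\ dphi 1 = 0
  | NF_FF => dphi 0 = 0 /\ dphi 1 + q 1 / D * phi 1 = 0
  | NF_H => dphi 0 = 0 /\ phi 1 = 0
  end.

(* The eigenvalue problem is self-adjoint for the weight exp (Q / D), Q' = q,
   so its eigenvalues are real and real eigenfunctions suffice. *)
Definition is_eigenvalue (D : R) (q r : R -> R) (bc : boundary_condition)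
    (lambda : R) : Prop :=
  exists phi dphi ddphi : R -> R,
    deriv_01 phi dphi /\ deriv_01 dphi ddphi /\ C0_01 ddphi /\
    (exists x, I01 x /\ phi x <> 0) /\
    (forall x, 0 < x < 1 ->
       - D * ddphi x - q x * dphi x - r x * phi x = lambda * phi x) /\
    satisfies_bc D q bc phi dphi.

Definition is_least (E : R -> Prop) (m : R) : Prop :=
  E m /\ forall y, E y -> m <= y.

(* The least element of E if there is one (it is then unique); an unspecified
   real otherwise. *)
Definition least (E : R -> Prop) : R := epsilon (inhabits 0) (is_least E).

Definition principal_eigenvalue (q r : R -> R) (bc : boundary_condition)
    (D : R) : R :=
  least (is_eigenvalue D q r bc).

Definition min_on (a b : R) (f : R -> R) : R :=
  least (fun y => exists x, a <= x <= b /\ y = f x).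

Definition lim_at_0_right (f : R -> R) (l : Rbar) : Prop :=
  filterlim f (at_right 0) (Rbar_locally l).

(* Main.v *)
(* Shooting.  Let y solve the equation with parameter lambda, y(0) = 1 and
   y'(0) = 0.  For lambda very negative, y and the boundary functional at 1 are
   positive; at the supremum of the parameters below which this persists, the
   boundary functional vanishes while y > 0 on [0,1), so this supremum is the
   least eigenvalue.

   Lower bounds: if k satisfies D (k' - k^2) + q k - r - lambda >= 0, then
   y' + k y stays positive and lambda is no eigenvalue.  When lambda <= L - e and
   L <= - r on the zero set of q, one takes k constant, or k = K (1 - x) if also
   L <= - r(1), with K large and then D small.

   Upper bounds: w = y'/y satisfies w' = - w^2 - (q/D) w - (r + lambda)/D.  On an
   interval where r + lambda >= c > 0 and q w >= 0 this gives
   w' <= - w^2 - c/D, and w blows up within a length of order sqrt (D/c).  This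
   applies where q = 0, and under NF/NF also near 1, where w >= 0 because
   w(1) = 0. *)
Require Import Defs.
From Stdlib Require Import Reals Lra Lia Classical ClassicalEpsilon.
From Coquelicot Require Import Coquelicot.
Open Scope R_scope.

(** * Elementary calculus on the real line *)

Lemma continuity_continuous (f : R -> R) (x : R) : continuity f -> continuous f x.
Proof. intros Hf. apply continuity_pt_filterlim, Hf. Qed.

Lemma nondecreasing_on (f df : R -> R) (a b : R) :
  a <= b -> (forall x, a <= x <= b -> continuity_pt f x) ->
  (forall x, a < x < b -> is_derive f x (df x)) ->
  (forall x, a < x < b -> 0 <= df x) -> f a <= f b.
Proof.
intros Hab Hc Hd Hp.
(* [MVT_gen] may return an endpoint, where nothing is known about [df]; truncation at 0 secures the
   sign there and changes nothing inside. *)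
destruct (MVT_gen f a b (fun x => Rmax (df x) 0)) as [c [_ Hc2]].
- rewrite Rmin_left, Rmax_right by exact Hab. intros x Hx.
  rewrite Rmax_left by (apply Hp; exact Hx). apply Hd, Hx.
- rewrite Rmin_left, Rmax_right by exact Hab. exact Hc.
- assert (0 <= Rmax (df c) 0 * (b - a))
    by (apply Rmult_le_pos; [apply Rmax_r | lra]).
  lra.
Qed.

Lemma ex_RInt_continuity (f : R -> R) (a b : R) : continuity f -> ex_RInt f a b.
Proof.
intros Hf. apply (ex_RInt_continuous (V := R_CompleteNormedModule)).
intros z _. now apply continuity_continuous.
Qed.

Lemma is_derive_RInt_continuity (f : R -> R) (x : R) :
  continuity f -> is_derive (RInt f 0) x (f x).
Proof.
intros Hf. apply is_derive_RInt with 0; [|now apply continuity_continuous].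
apply filter_forall; intros b.
apply (RInt_correct (V := R_CompleteNormedModule)), ex_RInt_continuity, Hf.
Qed.

Lemma continuity_RInt (f : R -> R) : continuity f -> continuity (RInt f 0).
Proof.
intros Hf x. apply continuity_pt_filterlim.
apply (ex_derive_continuous (RInt f 0)). exists (f x).
now apply is_derive_RInt_continuity.
Qed.

(** [auto_derive] leaves [Derive] terms for functions known only through a hypothesis [is_derive];
    this replaces them by the derivative given in [H]. *)
Ltac rewrite_derive H :=
  match type of H with is_derive ?f ?x ?l =>
    replace (Derive (fun t : R => f t) x) with l
      by (symmetry; exact (is_derive_unique f x l H)) end.

Lemma bounded_on_I01 (f : R -> R) :
  continuity f -> exists M, 0 < M /\ forall x, 0 <= x <= 1 -> Rabs (f x) <= M.
Proof.
intros Hf.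
destruct (continuity_ab_maj (fun x => Rabs (f x)) 0 1) as [m [Hm _]].
- lra.
- intros c _. reg.
- exists (Rabs (f m) + 1). split.
  + pose proof (Rabs_pos (f m)). lra.
  + intros x Hx. specialize (Hm x Hx). simpl in Hm. lra.
Qed.

(** * Volterra equations *)

(** Projection onto [0,1]. Precomposition with it turns a function continuous relative to [0,1] into
    one continuous on the real line, with the same values on [0,1]. *)
Definition clamp (x : R) : R := Rmax 0 (Rmin x 1).

Lemma clamp_I01 (x : R) : 0 <= clamp x <= 1.
Proof. unfold clamp, Rmax, Rmin. repeat destruct Rle_dec; lra. Qed.

Lemma clamp_id (x : R) : 0 <= x <= 1 -> clamp x = x.
Proof. intros Hx. unfold clamp. rewrite Rmin_left, Rmax_right; lra. Qed.

Lemma clamp_lipschitz (x y : R) : Rabs (clamp x - clamp y) <= Rabs (x - y).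
Proof.
unfold clamp, Rmax, Rmin.
repeat destruct Rle_dec; unfold Rabs; repeat destruct Rcase_abs; lra.
Qed.

Lemma continuity_clamp : continuity clamp.
Proof.
intros x e He. exists e. split; [exact He|]. intros y [_ Hy].
simpl in *. unfold Rdist in *. pose proof (clamp_lipschitz y x). lra.
Qed.

(** With [g] = exp(-Q/D) and [h] = -exp(Q/D) (r + lambda)/D, where Q' = q, the equation y = 1 +
    [volterra g h y] is the twice integrated form of (exp(Q/D) y')' = -exp(Q/D) (r + lambda) y / D
    with y(0) = 1, y'(0) = 0. *)
Definition volterra (g h f : R -> R) (x : R) : R :=
  RInt (fun s => g s * RInt (fun t => h t * f t) 0 s) 0 x.

Lemma continuity_volterra_integrand (g h f : R -> R) :
  continuity g -> continuity h -> continuity f ->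
  continuity (fun s => g s * RInt (fun t => h t * f t) 0 s).
Proof.
intros Hg Hh Hf. assert (Hi : continuity (fun t => h t * f t)) by reg.
apply continuity_RInt in Hi. reg.
Qed.

Lemma continuity_volterra (g h f : R -> R) :
  continuity g -> continuity h -> continuity f -> continuity (volterra g h f).
Proof.
intros Hg Hh Hf.
apply (continuity_RInt (fun s => g s * RInt (fun t => h t * f t) 0 s)).
now apply continuity_volterra_integrand.
Qed.

Lemma volterra_minus (g h f1 f2 : R -> R) (x : R) :
  continuity g -> continuity h -> continuity f1 -> continuity f2 ->
  volterra g h f1 x - volterra g h f2 x = volterra g h (fun t => f1 t - f2 t) x.
Proof.
intros Hg Hh Hf1 Hf2. unfold volterra.
rewrite <- (RInt_minus (V := R_CompleteNormedModule));
  [|now apply ex_RInt_continuity, continuity_volterra_integrand..].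
apply RInt_ext. intros s _. cbn.
assert (E : RInt (fun t => h t * (f1 t - f2 t)) 0 s =
  RInt (fun t => h t * f1 t) 0 s - RInt (fun t => h t * f2 t) 0 s).
{ etransitivity; [|apply (RInt_minus (V := R_CompleteNormedModule));
    apply ex_RInt_continuity; reg].
  apply RInt_ext. intros t _. cbn. unfold minus, plus, opp; cbn. ring. }
etransitivity; [|exact (f_equal (Rmult (g s)) (eq_sym E))].
unfold minus, plus, opp; cbn. ring.
Qed.

(** Both B/L exp(Lx) + G(x) and B/L exp(Lx) - G(x), with G the integral of [g] from 0, equal B/L at
    0 and have derivatives B exp(Lx) + g and B exp(Lx) - g, which are nonnegative. *)
Lemma RInt_exp_bound (g : R -> R) (B L x : R) :
  continuity g -> 0 <= B -> 0 < L ->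
  (forall t, 0 <= t <= 1 -> Rabs (g t) <= B * exp (L * t)) ->
  0 <= x <= 1 -> Rabs (RInt g 0 x) <= B / L * exp (L * x).
Proof.
intros Hg HB HL Hb Hx.
pose proof (continuity_RInt g Hg) as Hi.
assert (H0 : RInt g 0 0 = 0) by apply (RInt_point (V := R_CompleteNormedModule)).
assert (HBL : 0 <= B / L) by (apply Rdiv_le_0_compat; lra).
apply Rabs_le. split.
- enough (0 <= B / L * exp (L * x) + RInt g 0 x) by lra.
  apply Rle_trans with (B / L * exp (L * 0) + RInt g 0 0).
  { rewrite H0, Rmult_0_r, exp_0. lra. }
  apply (nondecreasing_on (fun x => B / L * exp (L * x) + RInt g 0 x)
           (fun x => B * exp (L * x) + g x)); [lra|intros; reg| |].
  + intros t _. pose proof (is_derive_RInt_continuity g t Hg) as Hd.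
    set (G := RInt g 0) in *. auto_derive; [eexists; exact Hd|].
    rewrite_derive Hd. field. lra.
  + intros t Ht. assert (Ht' : 0 <= t <= 1) by lra.
    apply Hb, Rabs_le_between in Ht'. lra.
- enough (0 <= B / L * exp (L * x) - RInt g 0 x) by lra.
  apply Rle_trans with (B / L * exp (L * 0) - RInt g 0 0).
  { rewrite H0, Rmult_0_r, exp_0. lra. }
  apply (nondecreasing_on (fun x => B / L * exp (L * x) - RInt g 0 x)
           (fun x => B * exp (L * x) - g x)); [lra|intros; reg| |].
  + intros t _. pose proof (is_derive_RInt_continuity g t Hg) as Hd.
    set (G := RInt g 0) in *. auto_derive; [eexists; exact Hd|].
    rewrite_derive Hd. field. lra.
  + intros t Ht. assert (Ht' : 0 <= t <= 1) by lra.
    apply Hb, Rabs_le_between in Ht'. lra.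
Qed.

(* A Bielecki weight exp (L x) makes the Volterra operator a contraction on the
   whole of [0,1]. *)
Lemma volterra_contraction (g h : R -> R) :
  continuity g -> continuity h ->
  exists L, 0 < L /\ forall f A x, continuity f -> 0 <= A ->
    (forall t, 0 <= t <= 1 -> Rabs (f t) <= A * exp (L * t)) ->
    0 <= x <= 1 -> Rabs (volterra g h f x) <= A / 2 * exp (L * x).
Proof.
intros Hg Hh.
destruct (bounded_on_I01 g Hg) as [G [HG Hgb]].
destruct (bounded_on_I01 h Hh) as [H [HH Hhb]].
assert (HGH : 0 < G * H) by (apply Rmult_lt_0_compat; lra).
(* Each of the two integrations gains a factor 1/L, so the operator has weighted norm at most
   GH/L^2, which is below 1/2 for this [L]. *)
set (L := 1 + 2 * (G * H)).
assert (HL : 0 < L) by (unfold L; lra).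
exists L. split; [exact HL|].
intros f A x Hf HA Hfb Hx.
apply Rle_trans with (G * (H * A / L) / L * exp (L * x)).
- apply RInt_exp_bound; try assumption.
  + now apply continuity_volterra_integrand.
  + apply Rmult_le_pos; [lra|]. apply Rdiv_le_0_compat; [|lra].
    apply Rmult_le_pos; lra.
  + intros s Hs. rewrite Rabs_mult, Rmult_assoc.
    apply Rmult_le_compat; try apply Rabs_pos; [now apply Hgb|].
    apply RInt_exp_bound; try assumption; [reg|apply Rmult_le_pos; lra|].
    intros t Ht. rewrite Rabs_mult, Rmult_assoc.
    apply Rmult_le_compat; try apply Rabs_pos; auto.
- apply Rmult_le_compat_r; [left; apply exp_pos|].
  replace (G * (H * A / L) / L) with (A * (G * H / (L * L))) by (field; lra).
  unfold Rdiv at 2. apply Rmult_le_compat_l; [exact HA|].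
  apply Rle_div_l; [nra|]. unfold L. nra.
Qed.

(** Telescoping makes the sequence uniformly Cauchy; the error bound is the limit of the Cauchy
    estimate, and continuity passes to the uniform limit. *)
Lemma geometric_uniform_limit (w : nat -> R -> R) (C : R) :
  (forall n, continuity (w n)) ->
  (forall n x, Rabs (w (S n) x - w n x) <= C * (1 / 2) ^ n) ->
  exists f, continuity f /\ forall n x, Rabs (w n x - f x) <= 2 * C * (1 / 2) ^ n.
Proof.
intros Hw Hd.
assert (HC : 0 <= C).
{ specialize (Hd 0%nat 0). pose proof (Rabs_pos (w 1%nat 0 - w 0%nat 0)).
  simpl in *. lra. }
assert (Hp : forall n, 0 < (1 / 2) ^ n) by (intro; apply pow_lt; lra).
(* The partial geometric sum is kept through the factor [1 - (1 / 2) ^ k], without which the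
   induction on [k] would not close. *)
assert (Hk : forall x n k, Rabs (w (n + k)%nat x - w n x)
           <= 2 * C * (1 / 2) ^ n * (1 - (1 / 2) ^ k)).
{ intros x n k. induction k as [|k IH].
  - rewrite Nat.add_0_r, Rminus_diag, Rabs_R0. simpl. lra.
  - replace (n + S k)%nat with (S (n + k)) by lia.
    specialize (Hd (n + k)%nat x). rewrite pow_add in Hd.
    replace (w (S (n + k)) x - w n x) with
      ((w (S (n + k)) x - w (n + k)%nat x) + (w (n + k)%nat x - w n x)) by ring.
    eapply Rle_trans; [apply Rabs_triang|]. simpl pow. lra. }
assert (Hk' : forall x n k, Rabs (w (n + k)%nat x - w n x) <= 2 * C * (1 / 2) ^ n).
{ intros x n k. eapply Rle_trans; [apply Hk|].
  assert (0 <= 2 * C * (1 / 2) ^ n).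
  { apply Rmult_le_pos; [lra|]. left; apply Hp. }
  specialize (Hp k). nra. }
(* The constant is 4C because two indices are compared through a common [N], each at cost 2C
   (1/2)^N. *)
assert (Hg : is_lim_seq (fun n => 4 * C * (1 / 2) ^ n) 0).
{ replace (Finite 0) with (Rbar_mult (4 * C) 0) by (simpl; f_equal; ring).
  apply is_lim_seq_scal_l, is_lim_seq_geom. rewrite Rabs_pos_eq; lra. }
assert (Hex : forall x, ex_finite_lim_seq (fun n => w n x)).
{ intros x. apply ex_lim_seq_cauchy_corr. intros e.
  apply is_lim_seq_spec in Hg. destruct (Hg e) as [N HN]. exists N.
  intros n m Hn Hm. specialize (HN N (le_n N)).
  rewrite Rminus_0_r in HN. apply Rabs_def2 in HN.
  replace n with (N + (n - N))%nat by lia. replace m with (N + (m - N))%nat by lia.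
  pose proof (Hk' x N (n - N)%nat). pose proof (Hk' x N (m - N)%nat).
  apply Rabs_def1; repeat match goal with H : Rabs _ <= _ |- _ =>
    apply Rabs_le_between in H end; lra. }
set (f := fun x => real (Lim_seq (fun n => w n x))).
assert (Hf : forall x, is_lim_seq (fun n => w n x) (f x)).
{ intros x. apply Lim_seq_correct'. apply Hex. }
assert (Hfw : forall n x, Rabs (w n x - f x) <= 2 * C * (1 / 2) ^ n).
{ intros n x. rewrite Rabs_minus_sym.
  apply (is_lim_seq_le (fun k => Rabs (w (k + n)%nat x - w n x))
           (fun _ => 2 * C * (1 / 2) ^ n) (Rabs (f x - w n x)) (2 * C * (1 / 2) ^ n)).
  - intros k. rewrite Nat.add_comm. apply Hk'.
  - apply (is_lim_seq_abs _ (f x - w n x)).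
    apply is_lim_seq_minus'; [|apply is_lim_seq_const].
    apply (is_lim_seq_incr_n (fun k => w k x)), Hf.
  - apply is_lim_seq_const. }
exists f. split; [|exact Hfw].
intros x. apply (CVU_continuity w f x (mkposreal 1 Rlt_0_1)).
- intros e He. apply is_lim_seq_spec in Hg.
  destruct (Hg (mkposreal e He)) as [N HN]. exists N.
  intros n y Hn _. specialize (HN n Hn). simpl in HN.
  rewrite Rminus_0_r in HN. apply Rabs_def2 in HN.
  rewrite Rabs_minus_sym. specialize (Hfw n y). specialize (Hp n). nra.
- intros n y _. apply Hw.
- unfold Boule. rewrite Rminus_diag, Rabs_R0. simpl. lra.
Qed.

Lemma exp_monotone (x y : R) : x <= y -> exp x <= exp y.
Proof.
intros [H|H]; [left; now apply exp_increasing|rewrite H; apply Rle_refl].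
Qed.

(** Picard iteration from 0, contracting by 1/2 in the norm with weight exp(Lx). *)
Lemma volterra_fixpoint (g h : R -> R) :
  continuity g -> continuity h ->
  exists f, continuity f /\
    forall x, 0 <= x <= 1 -> f x = 1 + volterra g h f x.
Proof.
intros Hg Hh.
destruct (volterra_contraction g h Hg Hh) as [L [HL Hcon]].
(* The iterates are evaluated at [clamp x], so that estimates proved on [0,1] hold on the whole
   line, as [geometric_uniform_limit] demands. *)
set (w := nat_rect (fun _ => R -> R) (fun _ => 0)
            (fun _ v x => 1 + volterra g h v (clamp x))).
assert (HwS : forall n x, w (S n) x = 1 + volterra g h (w n) (clamp x))
  by reflexivity.
assert (Hwc : forall n, continuity (w n)).
{ intros n. induction n as [|n IH]; [intros x; apply continuity_const; now intros ? ?|].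
  apply (continuity_plus (fun _ => 1)); [apply continuity_const; now intros ? ?|].
  apply (continuity_comp clamp (volterra g h (w n)));
    [apply continuity_clamp|now apply continuity_volterra]. }
assert (Hd : forall n x, 0 <= x <= 1 ->
  Rabs (w (S n) x - w n x) <= (1 / 2) ^ n * exp (L * x)).
{ intros n. induction n as [|n IH]; intros x Hx.
  - change (w 0%nat x) with 0. rewrite HwS, clamp_id by exact Hx.
    eapply Rle_trans; [|].
    2: { rewrite Rmult_1_l. apply Rle_trans with 1; [apply Rle_refl|].
         rewrite <- exp_0. apply exp_monotone. nra. }
    assert (Hz := Hcon (w 0%nat) 0 x (Hwc 0%nat) (Rle_refl 0)).
    unfold Rdiv in Hz. rewrite !Rmult_0_l in Hz.
    assert (Hz' : Rabs (volterra g h (w 0%nat) x) <= 0).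
    { apply Hz; [|exact Hx]. intros t _. change (w 0%nat t) with 0.
      rewrite Rabs_R0. lra. }
    apply Rabs_le_between in Hz'. apply Rabs_le. lra.
  - rewrite !(HwS _ x), clamp_id by exact Hx.
    replace (1 + volterra g h (w (S n)) x - (1 + volterra g h (w n) x)) with
      (volterra g h (w (S n)) x - volterra g h (w n) x) by ring.
    rewrite volterra_minus by auto.
    replace ((1 / 2) ^ S n) with ((1 / 2) ^ n / 2) by (simpl; field).
    apply Hcon; try assumption.
    + apply (continuity_minus (w (S n)) (w n)); auto.
    + apply pow_le; lra. }
destruct (geometric_uniform_limit w (exp L)) as [f [Hfc Hf]].
{ exact Hwc. }
{ intros n x.
  assert (E : forall n, w n x = w n (clamp x)).
  { intros [|m]; [reflexivity|]. rewrite !HwS, (clamp_id (clamp x)) by apply clamp_I01.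
    reflexivity. }
  rewrite !E, Rmult_comm. pose proof (clamp_I01 x).
  eapply Rle_trans; [apply Hd; lra|].
  apply Rmult_le_compat_l; [apply pow_le; lra|]. apply exp_monotone. nra. }
exists f. split; [exact Hfc|]. intros x Hx.
(* The residual of [f] is compared with iterate n + 1: one term bounds [w (S n) x - f x], the other
   the image of [w n - f] under the contraction. Both decay like (1/2)^n, so the residual
   vanishes. *)
set (C := 2 * exp L + exp L * exp (L * x)).
assert (Hb : forall n, Rabs (f x - (1 + volterra g h f x)) <= C * (1 / 2) ^ n).
{ intros n. pose proof (Hf (S n) x) as H1. rewrite HwS, clamp_id in H1 by exact Hx.
  assert (H2 : Rabs (volterra g h (fun t => w n t - f t) x)
                 <= (2 * exp L * (1 / 2) ^ n) / 2 * exp (L * x)).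
  { assert (0 <= 2 * exp L * (1 / 2) ^ n).
    { apply Rmult_le_pos; [pose proof (exp_pos L); lra|apply pow_le; lra]. }
    apply Hcon; try assumption.
    - apply (continuity_minus (w n) f); auto.
    - intros t Ht. apply Rle_trans with (1 := Hf n t).
      rewrite <- (Rmult_1_r (2 * exp L * (1 / 2) ^ n)) at 1.
      apply Rmult_le_compat_l; [assumption|]. rewrite <- exp_0. apply exp_monotone. nra. }
  rewrite <- volterra_minus in H2 by auto.
  unfold C. simpl pow in H1.
  assert (0 <= exp L * (1 / 2) ^ n).
  { apply Rmult_le_pos; [pose proof (exp_pos L); lra|apply pow_le; lra]. }
  apply Rabs_le_between in H1. apply Rabs_le_between in H2. apply Rabs_le. nra. }
assert (Hl : is_lim_seq (fun n => C * (1 / 2) ^ n) 0).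
{ replace (Finite 0) with (Rbar_mult C 0) by (simpl; f_equal; ring).
  apply is_lim_seq_scal_l, is_lim_seq_geom. rewrite Rabs_pos_eq; lra. }
assert (Hz := is_lim_seq_le _ _ _ _ Hb (is_lim_seq_const _) Hl). simpl in Hz.
apply Rabs_le_between in Hz. lra.
Qed.

(** * Linear differential inequalities *)

(** If [h t <= 0] for some [t], let m be the supremum of the points up to which [h] is positive. The
    step hypothesis gives h(m) > 0, and continuity carries positivity beyond m, a contradiction. *)
Lemma continuous_induction (h : R -> R) :
  continuity h -> 0 < h 0 ->
  (forall t, 0 < t <= 1 -> (forall s, 0 <= s < t -> 0 < h s) -> 0 < h t) ->
  forall t, 0 <= t <= 1 -> 0 < h t.
Proof.
intros Hh H0 Hstep t Ht. apply Rnot_le_lt. intros Hle.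
set (E := fun s => 0 <= s <= t /\ forall u, 0 <= u <= s -> 0 < h u).
assert (E0 : E 0).
{ split; [lra|]. intros u Hu. replace u with 0 by lra. exact H0. }
destruct (completeness E) as [m [Hub Hlub]].
{ exists t. intros s [Hs _]. lra. }
{ exists 0. exact E0. }
assert (Hm0 : 0 <= m) by (apply Hub, E0).
assert (Hmt : m <= t) by (apply Hlub; intros s [Hs _]; lra).
assert (Hlt : forall s, 0 <= s < m -> 0 < h s).
{ intros s Hs. apply Rnot_le_lt. intros Hn.
  enough (m <= s) by lra. apply Hlub. intros u [Hu1 Hu2].
  apply Rnot_lt_le. intros Hsu. specialize (Hu2 s). lra. }
assert (Hm : 0 < h m).
{ destruct (Rle_lt_or_eq_dec 0 m Hm0) as [Hp|He].
  - apply Hstep; [lra|exact Hlt].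
  - rewrite <- He. exact H0. }
assert (Hne : m < t).
{ destruct (Rle_lt_or_eq_dec m t Hmt) as [Hp|He]; [lra|subst; lra]. }
destruct (Hh m (h m) Hm) as [d [Hd Hc]].
assert (Hin : E (Rmin t (m + d / 2))).
{ assert (Hmin : m < Rmin t (m + d / 2)) by (apply Rmin_glb_lt; lra).
  pose proof (Rmin_l t (m + d / 2)). pose proof (Rmin_r t (m + d / 2)).
  split; [lra|]. intros u Hu.
  destruct (Rlt_le_dec u m) as [Hum|Hum]; [apply Hlt; lra|].
  destruct (Req_dec m u) as [->|Hnu]; [exact Hm|].
  assert (Hdist : Rabs (h u - h m) < h m).
  { apply Hc. split; [split; [exact I|exact Hnu]|].
    simpl. unfold Rdist. rewrite Rabs_pos_eq; lra. }
  apply Rabs_def2 in Hdist. lra. }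
apply Hub in Hin.
assert (m < Rmin t (m + d / 2)) by (apply Rmin_glb_lt; lra). lra.
Qed.

(** While [y] and [g] are both positive, exp(Nx) y and exp(Nx) g are nondecreasing, so neither can
    reach 0; continuous induction is applied to their minimum. The intended [g] is y' + k y. *)
Lemma positive_linear_system (y g k alpha beta : R -> R) (N : R) :
  continuity y -> continuity g -> 0 < y 0 -> 0 < g 0 ->
  (forall x, 0 < x < 1 ->
    is_derive y x (g x - k x * y x) /\
    is_derive g x (alpha x * g x + beta x * y x) /\
    k x <= N /\ - N <= alpha x /\ 0 <= beta x) ->
  forall x, 0 <= x <= 1 -> 0 < y x /\ 0 < g x.
Proof.
intros Hy Hg Hy0 Hg0 Hs.
assert (Hm : forall x, 0 <= x <= 1 -> 0 < Rmin (y x) (g x)).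
{ apply (continuous_induction (fun x => Rmin (y x) (g x))).
  - assert (E : forall x, Rmin (y x) (g x) = (y x + g x - Rabs (y x - g x)) / 2).
    { intros x. unfold Rmin, Rabs. destruct Rle_dec, Rcase_abs; lra. }
    assert (Hc : continuity (fun x => (y x + g x - Rabs (y x - g x)) / 2)) by reg.
    intros x. apply (continuity_pt_ext _ _ _ (fun t => eq_sym (E t))), Hc.
  - now apply Rmin_glb_lt.
  - intros t Ht Hpos.
    assert (Hpos' : forall s, 0 <= s < t -> 0 < y s /\ 0 < g s).
    { intros s Hs'. specialize (Hpos s Hs').
      pose proof (Rmin_l (y s) (g s)). pose proof (Rmin_r (y s) (g s)). lra. }
    assert (Hyt : y 0 * exp (N * 0) <= y t * exp (N * t)).
    { apply (nondecreasing_on (fun x => y x * exp (N * x))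
         (fun x => (g x - k x * y x) * exp (N * x) + y x * (N * exp (N * x))));
        [lra|intros; reg| |]; intros x Hx.
      - destruct (Hs x) as [Hd _]; [lra|]. auto_derive; [eexists; exact Hd|].
        rewrite_derive Hd. ring.
      - destruct (Hs x) as [_ [_ [Hk _]]]; [lra|].
        destruct (Hpos' x) as [Py Pg]; [lra|].
        replace (_ + _) with (exp (N * x) * (g x + (N - k x) * y x)) by ring.
        apply Rmult_le_pos; [left; apply exp_pos|]. nra. }
    assert (Hgt : g 0 * exp (N * 0) <= g t * exp (N * t)).
    { apply (nondecreasing_on (fun x => g x * exp (N * x))
         (fun x => (alpha x * g x + beta x * y x) * exp (N * x)
                    + g x * (N * exp (N * x))));
        [lra|intros; reg| |]; intros x Hx.
      - destruct (Hs x) as [_ [Hd _]]; [lra|]. auto_derive; [eexists; exact Hd|].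
        rewrite_derive Hd. ring.
      - destruct (Hs x) as [_ [_ [_ [Ha Hb]]]]; [lra|].
        destruct (Hpos' x) as [Py Pg]; [lra|].
        replace (_ + _) with
          (exp (N * x) * ((N + alpha x) * g x + beta x * y x)) by ring.
        apply Rmult_le_pos; [left; apply exp_pos|].
        apply Rplus_le_le_0_compat; apply Rmult_le_pos; lra. }
    rewrite Rmult_0_r, exp_0 in Hyt, Hgt. pose proof (exp_pos (N * t)).
    apply Rmin_glb_lt; nra. }
intros x Hx. specialize (Hm x Hx).
pose proof (Rmin_l (y x) (g x)). pose proof (Rmin_r (y x) (g x)). lra.
Qed.

(** Gronwall in both directions: E = d^2 + e^2 + H^2 satisfies |E'| <= (3M + 2) E. The constant
    summand H^2 absorbs the forcing term [h]. The backward bound carries vanishing data at a point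
    back to 0. *)
Lemma linear_energy_bound (d e a b h : R -> R) (M H : R) :
  continuity d -> continuity e -> 0 <= M ->
  (forall x, 0 < x < 1 ->
    is_derive d x (e x) /\ is_derive e x (a x * e x + b x * d x + h x) /\
    Rabs (a x) <= M /\ Rabs (b x) <= M /\ Rabs (h x) <= H) ->
  forall x, 0 <= x <= 1 ->
    d x ^ 2 + e x ^ 2 + H ^ 2 <=
      (d 0 ^ 2 + e 0 ^ 2 + H ^ 2) * exp ((3 * M + 2) * x) /\
    d 0 ^ 2 + e 0 ^ 2 + H ^ 2 <=
      (d x ^ 2 + e x ^ 2 + H ^ 2) * exp ((3 * M + 2) * x).
Proof.
intros Hd He HM Hs x Hx. set (C := 3 * M + 2).
set (E := fun x => d x ^ 2 + e x ^ 2 + H ^ 2).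
set (dE := fun x => 2 * d x * e x + 2 * e x * (a x * e x + b x * d x + h x)).
assert (HE : forall t, 0 < t < 1 -> is_derive E t (dE t)).
{ intros t Ht. destruct (Hs t Ht) as [D1 [D2 _]]. unfold E, dE.
  auto_derive; [repeat split; eexists; eassumption|].
  rewrite_derive D1. rewrite_derive D2. ring. }
assert (HEc : continuity E) by (unfold E; reg).
assert (HdE : forall t, 0 < t < 1 -> Rabs (dE t) <= C * E t).
{ intros t Ht. destruct (Hs t Ht) as [_ [_ [Ha [Hb Hh]]]].
  apply Rabs_le_between in Ha, Hb, Hh.
  assert (Hh2 : h t ^ 2 <= H ^ 2) by nra.
  assert (T1 : - (d t ^ 2 + e t ^ 2) <= 2 * d t * e t <= d t ^ 2 + e t ^ 2)
    by (pose proof (pow2_ge_0 (d t + e t)); pose proof (pow2_ge_0 (d t - e t));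
        split; lra).
  assert (T2 : - (2 * M * e t ^ 2) <= 2 * (a t * e t ^ 2) <= 2 * M * e t ^ 2)
    by (pose proof (pow2_ge_0 (e t)); split; nra).
  assert (T3 : - (M * (d t ^ 2 + e t ^ 2)) <= b t * (2 * d t * e t)
                 <= M * (d t ^ 2 + e t ^ 2)).
  { assert (Rabs (b t * (2 * d t * e t)) <= M * (d t ^ 2 + e t ^ 2)).
    { rewrite Rabs_mult. apply Rmult_le_compat; try apply Rabs_pos; apply Rabs_le; lra. }
    now apply Rabs_le_between. }
  assert (T4 : - (e t ^ 2 + H ^ 2) <= 2 * e t * h t <= e t ^ 2 + H ^ 2)
    by (pose proof (pow2_ge_0 (e t + h t)); pose proof (pow2_ge_0 (e t - h t));
        split; lra).
  pose proof (pow2_ge_0 (d t)). pose proof (pow2_ge_0 (e t)).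
  assert (0 <= M * d t ^ 2) by (apply Rmult_le_pos; lra).
  assert (0 <= M * H ^ 2) by (apply Rmult_le_pos; [lra|apply pow2_ge_0]).
  pose proof (pow2_ge_0 H).
  apply Rabs_le. unfold dE, E, C. split; lra. }
assert (Hp : 0 < exp (C * x)) by apply exp_pos.
change (E x <= E 0 * exp (C * x) /\ E 0 <= E x * exp (C * x)). split.
- assert (Hm : - (E 0 * exp (- (C * 0))) <= - (E x * exp (- (C * x)))).
  { apply (nondecreasing_on (fun x => - (E x * exp (- (C * x))))
      (fun x => (C * E x - dE x) * exp (- (C * x)))); [lra|intros; reg| |];
      intros t Ht; assert (Ht' : 0 < t < 1) by lra.
    - pose proof (HE t Ht') as D1. clearbody E dE. auto_derive; [eexists; exact D1|].
      rewrite_derive D1. ring.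
    - specialize (HdE t Ht'). apply Rabs_le_between in HdE.
      apply Rmult_le_pos; [lra|left; apply exp_pos]. }
  rewrite Rmult_0_r, Ropp_0, exp_0, exp_Ropp in Hm.
  apply Rle_div_l; [exact Hp|]. unfold Rdiv. lra.
- assert (Hm : E 0 * exp (C * 0) <= E x * exp (C * x)).
  { apply (nondecreasing_on (fun x => E x * exp (C * x))
      (fun x => (C * E x + dE x) * exp (C * x))); [lra|intros; reg| |];
      intros t Ht; assert (Ht' : 0 < t < 1) by lra.
    - pose proof (HE t Ht') as D1. clearbody E dE. auto_derive; [eexists; exact D1|].
      rewrite_derive D1. ring.
    - specialize (HdE t Ht'). apply Rabs_le_between in HdE.
      apply Rmult_le_pos; [lra|left; apply exp_pos]. }
  rewrite Rmult_0_r, exp_0 in Hm. lra.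
Qed.

Lemma is_derive_eq (f : R -> R) (x l l' : R) :
  is_derive f x l -> l = l' -> is_derive f x l'.
Proof. now intros H <-. Qed.

(** * Shooting solutions and eigenvalues *)

(** The equation as a first-order system, with z = y'. It is imposed on the open interval only,
    because an eigenfunction composed with [clamp] need not be differentiable at the endpoints. *)
Definition initial_solution (D : R) (q r : R -> R) (lam : R) (y z : R -> R) : Prop :=
  continuity y /\ continuity z /\ y 0 = 1 /\ z 0 = 0 /\
  forall x, 0 < x < 1 ->
    is_derive y x (z x) /\
    is_derive z x (- (q x * z x + (r x + lam) * y x) / D).

(** The integrating factor exp(Q/D) reduces the problem to the Volterra fixed point. Validity of the
    equations on the closed interval is recorded because eigenfunctions need one-sided derivatives
    at 0 and 1. *)
Lemma initial_solution_exists (D : R) (q r : R -> R) (lam : R) :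
  0 < D -> continuity q -> continuity r ->
  exists y z, initial_solution D q r lam y z /\
    forall x, 0 <= x <= 1 ->
      is_derive y x (z x) /\
      is_derive z x (- (q x * z x + (r x + lam) * y x) / D).
Proof.
intros HD Hq Hr. set (Q := RInt q 0).
assert (HQ : continuity Q) by now apply continuity_RInt.
set (g := fun x => exp (- Q x / D)).
set (h := fun x => - (exp (Q x / D) * (r x + lam)) / D).
assert (Hg : continuity g) by (unfold g; reg).
assert (Hh : continuity h) by (unfold h; reg).
destruct (volterra_fixpoint g h Hg Hh) as [f [Hf Hfix]].
set (v := RInt (fun t => h t * f t) 0).
assert (Hhf : continuity (fun t => h t * f t)) by reg.
assert (Hv : continuity v) by now apply continuity_RInt.
(* [y] is the right-hand side of the fixed-point equation: it is differentiable everywhere, whereas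
   [f] is known to agree with it only on [0,1]. *)
set (y := fun x => 1 + volterra g h f x). set (z := fun x => g x * v x).
assert (HT : continuity (volterra g h f)) by now apply continuity_volterra.
assert (Hy : continuity y) by (unfold y; reg).
assert (Hz : continuity z) by (unfold z; reg).
assert (Hdy : forall x, is_derive y x (z x)).
{ intros x. unfold y.
  assert (H1 : is_derive (volterra g h f) x (z x)).
  { apply (is_derive_RInt_continuity z x Hz). }
  set (T := volterra g h f) in *. clearbody T.
  auto_derive; [repeat split; eexists; eassumption|].
  rewrite_derive H1. ring. }
assert (Hdz : forall x, 0 <= x <= 1 ->
  is_derive z x (- (q x * z x + (r x + lam) * y x) / D)).
{ intros x Hx. unfold z at 1.
  assert (H1 : is_derive v x (h x * f x))
    by exact (is_derive_RInt_continuity _ x Hhf).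
  assert (H2 : is_derive Q x (q x)) by exact (is_derive_RInt_continuity _ x Hq).
  assert (Ey : f x = y x) by now apply Hfix.
  unfold z. clearbody v Q. unfold g.
  auto_derive; [repeat split; eexists; eassumption|].
  rewrite_derive H1. rewrite_derive H2. rewrite <- Ey. unfold h.
  replace (Q x / D) with (- (- Q x / D)) by (field; lra).
  rewrite exp_Ropp. fold (- Q x / D).
  pose proof (exp_pos (- Q x / D)). field. lra. }
exists y, z. split; [|now split; auto].
split; [exact Hy|]. split; [exact Hz|].
split; [|split].
- unfold y, volterra. rewrite (RInt_point (V := R_CompleteNormedModule)).
  unfold zero; cbn. ring.
- unfold z, v. rewrite (RInt_point (V := R_CompleteNormedModule)).
  unfold zero; cbn. ring.
- intros x Hx. split; [apply Hdy|apply Hdz; lra].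
Qed.

Lemma coefficient_bound (D : R) (q r : R -> R) (lam : R) :
  0 < D -> continuity q -> continuity r ->
  exists M, 0 <= M /\ forall x, 0 <= x <= 1 ->
    Rabs (- q x / D) <= M /\ Rabs (- (r x + lam) / D) <= M.
Proof.
intros HD Hq Hr.
destruct (bounded_on_I01 (fun x => - q x / D)) as [M1 [HM1 H1]]; [reg|].
destruct (bounded_on_I01 (fun x => - (r x + lam) / D)) as [M2 [HM2 H2]]; [reg|].
exists (Rmax M1 M2). split.
- pose proof (Rmax_l M1 M2). lra.
- intros x Hx. split.
  + eapply Rle_trans; [now apply H1|apply Rmax_l].
  + eapply Rle_trans; [now apply H2|apply Rmax_r].
Qed.

(** The energy estimate without forcing, [H] = 0, bounds y^2 + z^2 at 0 and at [x] by multiples of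
    each other. *)
Lemma solution_zero_data (D : R) (q r : R -> R) (lam : R) (y z : R -> R) :
  0 < D -> continuity q -> continuity r -> continuity y -> continuity z ->
  (forall x, 0 < x < 1 -> is_derive y x (z x) /\
    is_derive z x (- (q x * z x + (r x + lam) * y x) / D)) ->
  forall x, 0 <= x <= 1 ->
    (y 0 = 0 /\ z 0 = 0 <-> y x = 0 /\ z x = 0).
Proof.
intros HD Hq Hr Hy Hz Hs x Hx.
destruct (coefficient_bound D q r lam HD Hq Hr) as [M [HM Hb]].
destruct (linear_energy_bound y z (fun x => - q x / D)
  (fun x => - (r x + lam) / D) (fun _ => 0) M 0 Hy Hz HM) with (x := x) as [H1 H2];
  [|exact Hx|].
- intros t Ht. destruct (Hs t Ht) as [D1 D2]. split; [exact D1|]. split.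
  + apply (is_derive_eq _ _ _ _ D2). field. lra.
  + destruct (Hb t); [lra|]. rewrite Rabs_R0. auto with real.
- pose proof (pow2_ge_0 (y x)). pose proof (pow2_ge_0 (z x)).
  pose proof (pow2_ge_0 (y 0)). pose proof (pow2_ge_0 (z 0)).
  split; intros [E1 E2]; rewrite E1, E2 in *.
  + replace (0 ^ 2 + 0 ^ 2 + 0 ^ 2) with 0 in H1 by ring. rewrite Rmult_0_l in H1.
    split; apply Rsqr_0_uniq; unfold Rsqr; lra.
  + replace (0 ^ 2 + 0 ^ 2 + 0 ^ 2) with 0 in H2 by ring. rewrite Rmult_0_l in H2.
    split; apply Rsqr_0_uniq; unfold Rsqr; lra.
Qed.

Lemma initial_solution_nondegenerate (D : R) (q r : R -> R) (lam : R)
    (y z : R -> R) :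
  0 < D -> continuity q -> continuity r -> initial_solution D q r lam y z ->
  forall x, 0 <= x <= 1 -> y x = 0 -> z x <> 0.
Proof.
intros HD Hq Hr [Hy [Hz [Hy0 [_ Hs]]]] x Hx E1 E2.
destruct (proj2 (solution_zero_data D q r lam y z HD Hq Hr Hy Hz Hs x Hx)
  (conj E1 E2)). lra.
Qed.

(** The difference of two solutions solves the system for [mu] with zero initial data and forcing
    -(mu - lam) y / D, so its energy is of order (mu - lam)^2. *)
Lemma initial_solution_continuous_dependence (D : R) (q r : R -> R) (lam : R)
    (y z : R -> R) :
  0 < D -> continuity q -> continuity r -> initial_solution D q r lam y z ->
  forall e, 0 < e -> exists d, 0 < d /\
    forall mu u v, Rabs (mu - lam) < d -> initial_solution D q r mu u v ->
    forall x, 0 <= x <= 1 -> Rabs (u x - y x) < e /\ Rabs (v x - z x) < e.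
Proof.
intros HD Hq Hr [Hy [Hz [Hy0 [Hz0 Hs]]]] e He.
destruct (coefficient_bound D q r lam HD Hq Hr) as [M0 [HM0 Hb]].
destruct (bounded_on_I01 y Hy) as [Y [HY Hyb]].
assert (HiD : 0 < / D) by now apply Rinv_0_lt_compat.
(* [M] bounds the coefficients for all [mu] within distance 1 of [lam]; [S] is the square root of
   the largest exponential factor, since the energy is quadratic. *)
set (M := M0 + / D). set (S := exp ((3 * M + 2) / 2)).
assert (HS : 0 < S) by apply exp_pos.
assert (HK : 0 < Y / D * S)
  by (apply Rmult_lt_0_compat; [now apply Rdiv_lt_0_compat|exact HS]).
exists (Rmin 1 (e / (Y / D * S))). split.
{ apply Rmin_glb_lt; [lra|now apply Rdiv_lt_0_compat]. }
intros mu u v Hmu [Hu [Hv [Hu0 [Hv0 Hs']]]] x Hx.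
assert (Hmu1 : Rabs (mu - lam) < 1) by (eapply Rlt_le_trans; [exact Hmu|apply Rmin_l]).
assert (Hmu2 : Rabs (mu - lam) * (Y / D * S) < e).
{ apply (Rlt_div_r (Rabs (mu - lam))); [exact HK|].
  eapply Rlt_le_trans; [exact Hmu|apply Rmin_r]. }
set (H := Rabs (mu - lam) * (Y / D)).
assert (HH : 0 <= H).
{ apply Rmult_le_pos; [apply Rabs_pos|]. left. now apply Rdiv_lt_0_compat. }
destruct (linear_energy_bound (fun x => u x - y x) (fun x => v x - z x)
  (fun x => - q x / D) (fun x => - (r x + mu) / D)
  (fun x => - (mu - lam) / D * y x) M H) with (x := x) as [H1 _];
  [reg|reg|unfold M; lra| |exact Hx|].
- intros t Ht. destruct (Hs t Ht) as [D1 D2], (Hs' t Ht) as [D3 D4].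
  assert (Ht' : 0 <= t <= 1) by lra. destruct (Hb t Ht') as [B1 B2].
  split; [|split; [|split; [|split]]].
  + exact (is_derive_minus u y t _ _ D3 D1).
  + apply (is_derive_eq _ _ _ _ (is_derive_minus v z t _ _ D4 D2)).
    unfold minus, plus, opp; cbn. field. lra.
  + unfold M. lra.
  + replace (- (r t + mu) / D) with (- (r t + lam) / D + - (mu - lam) * / D)
      by (field; lra).
    eapply Rle_trans; [apply Rabs_triang|]. unfold M.
    rewrite Rabs_mult, Rabs_Ropp, (Rabs_pos_eq (/ D)) by lra. nra.
  + unfold H, Rdiv. rewrite !Rabs_mult, Rabs_Ropp, (Rabs_pos_eq (/ D)) by lra.
    specialize (Hyb t Ht'). pose proof (Rabs_pos (mu - lam)).
    rewrite (Rmult_comm Y), <- Rmult_assoc. apply Rmult_le_compat_l; [nra|exact Hyb].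
- assert (HE : (u x - y x) ^ 2 + (v x - z x) ^ 2 <= (H * S) ^ 2).
  { rewrite Hu0, Hy0, Hv0, Hz0 in H1.
    replace ((1 - 1) ^ 2 + (0 - 0) ^ 2 + H ^ 2) with (H ^ 2) in H1 by ring.
    assert (Hx2 : exp ((3 * M + 2) * x) <= S ^ 2).
    { unfold S. simpl. rewrite Rmult_1_r, <- exp_plus. apply exp_monotone.
      unfold M. nra. }
    pose proof (pow2_ge_0 H).
    assert (H ^ 2 * exp ((3 * M + 2) * x) <= H ^ 2 * S ^ 2)
      by (apply Rmult_le_compat_l; assumption).
    rewrite Rpow_mult_distr. lra. }
  assert (HHS : H * S < e) by (unfold H; lra).
  assert (HHS0 : 0 <= H * S) by (apply Rmult_le_pos; lra).
  pose proof (pow2_ge_0 (u x - y x)). pose proof (pow2_ge_0 (v x - z x)).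
  split; apply Rle_lt_trans with (2 := HHS); rewrite <- (Rabs_pos_eq _ HHS0);
    apply Rsqr_le_abs_0; unfold Rsqr; lra.
Qed.

(** * Transfer between [0,1] and the real line, and the eigenvalue criterion *)

Lemma C0_01_clamp (f : R -> R) : C0_01 f -> continuity (fun x => f (clamp x)).
Proof.
intros Hf x e He.
destruct (Hf (clamp x) (clamp_I01 x) e He) as [d [Hd Hc]].
exists d. split; [exact Hd|]. intros y [_ Hy]. simpl in *.
(* The limit in [continue_in] excludes the base point, so distinct points with the same projection
   are treated separately. *)
destruct (Req_dec (clamp x) (clamp y)) as [E|E].
- unfold Rdist. rewrite E, Rminus_diag, Rabs_R0. exact He.
- apply Hc. split; [split; [apply clamp_I01|exact E]|].
  eapply Rle_lt_trans; [apply clamp_lipschitz|exact Hy].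
Qed.

Lemma continuity_C0_01 (f : R -> R) : continuity f -> C0_01 f.
Proof.
intros Hf x _ e He. destruct (Hf x e He) as [d [Hd Hc]].
exists d. split; [exact Hd|]. intros y [[_ Hn] Hy]. apply Hc.
split; [split; [exact I|exact Hn]|exact Hy].
Qed.

Lemma deriv_01_interior (f df : R -> R) (x : R) :
  deriv_01 f df -> 0 < x < 1 -> is_derive (fun t => f (clamp t)) x (df x).
Proof.
intros Hf Hx. apply is_derive_Reals. intros e He.
assert (Ix : I01 x) by (unfold I01; lra).
destruct (Hf x Ix e He) as [d [Hd Hc]].
assert (Hm : 0 < Rmin d (Rmin x (1 - x))) by (repeat apply Rmin_glb_lt; lra).
exists (mkposreal _ Hm). simpl. intros h Hh Hhd.
pose proof (Rmin_l d (Rmin x (1 - x))). pose proof (Rmin_r d (Rmin x (1 - x))).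
pose proof (Rmin_l x (1 - x)). pose proof (Rmin_r x (1 - x)).
assert (Hh2 := Rabs_def2 _ _ Hhd).
rewrite !clamp_id by lra.
specialize (Hc (x + h)). simpl in Hc. unfold Rdist in Hc.
replace (x + h - x) with h in Hc by ring. apply Hc.
split; [split; [unfold I01; lra|lra]|lra].
Qed.

Lemma is_derive_deriv_01 (f df : R -> R) :
  (forall x, 0 <= x <= 1 -> is_derive f x (df x)) -> deriv_01 f df.
Proof.
intros Hf x Hx e He.
destruct (proj1 (is_derive_Reals f x (df x)) (Hf x Hx) e He) as [d Hd].
exists d. split; [apply cond_pos|]. intros y [[_ Hn] Hy].
simpl in *. unfold Rdist in *.
specialize (Hd (y - x)). replace (x + (y - x)) with y in Hd by ring.
apply Hd; [lra|exact Hy].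
Qed.

(** Continuous dependence at [mu] = [lam] makes the difference smaller than every positive [e]. *)
Lemma initial_solution_unique (D : R) (q r : R -> R) (lam : R) (y z u v : R -> R) :
  0 < D -> continuity q -> continuity r ->
  initial_solution D q r lam y z -> initial_solution D q r lam u v ->
  forall x, 0 <= x <= 1 -> u x = y x /\ v x = z x.
Proof.
intros HD Hq Hr Hyz Huv x Hx.
assert (H : forall e, 0 < e -> Rabs (u x - y x) < e /\ Rabs (v x - z x) < e).
{ intros e He.
  destruct (initial_solution_continuous_dependence D q r lam y z HD Hq Hr Hyz e He)
    as [d [Hd H]].
  apply (H lam u v); auto. rewrite Rminus_diag, Rabs_R0. exact Hd. }
split; apply Rminus_diag_uniq; apply Rabs_eq_0; apply Rle_antisym;
  try apply Rabs_pos; apply Rnot_lt_le; intros Hl; apply H in Hl; lra.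
Qed.

(** The condition at 0 is built into [initial_solution]; only the functional at 1 remains. *)
Definition bc_value (D : R) (q : R -> R) (bc : boundary_condition)
    (y z : R -> R) : R :=
  match bc with
  | NF_NF => z 1
  | NF_FF => z 1 + q 1 / D * y 1
  | NF_H => y 1
  end.

(** An eigenfunction cannot vanish at 0, since with phi'(0) = 0 it would vanish identically; divided
    by phi(0) it is the shooting solution. Conversely a shooting solution that meets the condition
    at 1 is an eigenfunction. *)
Lemma is_eigenvalue_iff (D : R) (q r : R -> R) (bc : boundary_condition)
    (lam : R) (y z : R -> R) :
  0 < D -> continuity q -> continuity r -> initial_solution D q r lam y z ->
  is_eigenvalue D q r bc lam <-> bc_value D q bc y z = 0.
Proof.
intros HD Hq Hr Hyz. split.
- intros (phi & dphi & ddphi & H1 & H2 & _ & [x1 [Ix1 Hx1]] & Heq & Hbc).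
  assert (H0 : dphi 0 = 0) by (destruct bc; apply Hbc).
  set (u := fun x => phi (clamp x)). set (v := fun x => dphi (clamp x)).
  assert (Hu : continuity u)
    by (apply C0_01_clamp; intros x Hx; apply cont_deriv with (1 := H1 x Hx)).
  assert (Hv : continuity v)
    by (apply C0_01_clamp; intros x Hx; apply cont_deriv with (1 := H2 x Hx)).
  assert (Hs : forall x, 0 < x < 1 -> is_derive u x (v x) /\
    is_derive v x (- (q x * v x + (r x + lam) * u x) / D)).
  { intros x Hx. unfold u, v. rewrite clamp_id by lra. split.
    - now apply deriv_01_interior.
    - apply (is_derive_eq _ _ _ _ (deriv_01_interior _ _ x H2 Hx)).
      specialize (Heq x Hx). apply Rmult_eq_reg_l with D; [|lra].
      field_simplify; lra. }
  assert (C0 : clamp 0 = 0) by (apply clamp_id; lra).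
  assert (C1 : clamp 1 = 1) by (apply clamp_id; lra).
  assert (Hphi : u 0 <> 0).
  { intros E. assert (Z : u 0 = 0 /\ v 0 = 0) by (unfold v; rewrite C0; auto).
    apply (solution_zero_data D q r lam u v HD Hq Hr Hu Hv Hs x1 Ix1) in Z as [Z _].
    apply Hx1. unfold u in Z. rewrite clamp_id in Z; auto. }
  destruct (initial_solution_unique D q r lam y z
    (fun x => / u 0 * u x) (fun x => / u 0 * v x) HD Hq Hr Hyz) with (x := 1)
    as [E1 E2]; [|lra|].
  + split; [reg|]. split; [reg|]. split; [now field|].
    split; [unfold v; rewrite C0, H0; ring|].
    intros x Hx. destruct (Hs x Hx) as [D1 D2]. split.
    * exact (is_derive_scal u x (/ u 0) (v x) D1).
    * apply (is_derive_eq _ _ _ _ (is_derive_scal v x (/ u 0) _ D2)).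
      field. lra.
  + unfold u at 2 in E1. unfold v in E2. rewrite C1 in E1, E2.
    unfold bc_value. rewrite <- E1, <- E2.
    destruct bc; destruct Hbc as [_ Hb].
    * rewrite Hb. ring.
    * transitivity (/ u 0 * (dphi 1 + q 1 / D * phi 1)); [ring|].
      rewrite Hb. ring.
    * rewrite Hb. ring.
- intros Hb.
  (* The given pair satisfies the equations only inside the interval; the constructed one is
     differentiable at the endpoints too, and uniqueness transfers the boundary value. *)
  destruct (initial_solution_exists D q r lam HD Hq Hr) as [u [v [Huv Hs]]].
  assert (E : bc_value D q bc u v = 0).
  { destruct (initial_solution_unique D q r lam y z u v HD Hq Hr Hyz Huv 1) as [E1 E2];
      [lra|]. unfold bc_value in *. rewrite E1, E2. exact Hb. }
  destruct Huv as [Hu [Hv [Hu0 [Hv0 _]]]].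
  exists u, v, (fun x => - (q x * v x + (r x + lam) * u x) / D).
  split; [apply is_derive_deriv_01; intros; now apply Hs|].
  split; [apply is_derive_deriv_01; intros; now apply Hs|].
  split; [apply continuity_C0_01; reg|].
  split; [exists 0; split; [unfold I01; lra|rewrite Hu0; lra]|].
  split; [intros x Hx; field; lra|].
  destruct bc; split; assumption.
Qed.

(** The eigenvalue problem sees the coefficients only on [0,1], so they may be replaced by
    extensions continuous on the line. *)
Lemma is_eigenvalue_clamp (D : R) (q r : R -> R) (bc : boundary_condition) (lam : R) :
  is_eigenvalue D q r bc lam <->
  is_eigenvalue D (fun x => q (clamp x)) (fun x => r (clamp x)) bc lam.
Proof.
assert (C1 : clamp 1 = 1) by (apply clamp_id; lra).
split; intros (phi & dphi & ddphi & H1 & H2 & H3 & H4 & Heq & Hbc);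
  exists phi, dphi, ddphi; repeat (split; [assumption|]); split.
- intros x Hx. rewrite clamp_id by lra. now apply Heq.
- unfold satisfies_bc. rewrite C1. exact Hbc.
- intros x Hx. specialize (Heq x Hx). rewrite clamp_id in Heq by lra. exact Heq.
- unfold satisfies_bc in Hbc. rewrite C1 in Hbc. exact Hbc.
Qed.

(* The barrier k(x) = K (1 - m x) keeps z + k y > 0; m = 1 makes it vanish at
   x = 1, which then yields z 1 > 0. *)
Lemma barrier_positivity (D : R) (q r : R -> R) (lam K m : R) (y z : R -> R) :
  0 < D -> continuity q -> continuity r -> initial_solution D q r lam y z ->
  0 < K -> 0 <= m <= 1 ->
  (forall x, 0 <= x <= 1 ->
    0 <= D * (- (K * m) - (K * (1 - m * x)) ^ 2) + q x * (K * (1 - m * x))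
           - (r x + lam)) ->
  forall x, 0 <= x <= 1 -> 0 < y x /\ 0 < z x + K * (1 - m * x) * y x.
Proof.
intros HD Hq Hr [Hy [Hz [Hy0 [Hz0 Hs]]]] HK Hm Hb.
destruct (coefficient_bound D q r lam HD Hq Hr) as [M [HM HMb]].
(* For g = z + k y the equation gives g' = (k - q/D) g + (k' - k^2 + (q k - r - lam)/D) y, and the
   hypothesis makes the coefficient of y nonnegative. *)
apply (positive_linear_system y (fun x => z x + K * (1 - m * x) * y x)
  (fun x => K * (1 - m * x)) (fun x => K * (1 - m * x) - q x / D)
  (fun x => - (K * m) - (K * (1 - m * x)) ^ 2
            + (q x * (K * (1 - m * x)) - (r x + lam)) / D) (K + M)).
- exact Hy.
- reg.
- rewrite Hy0. lra.
- rewrite Hy0, Hz0. lra.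
- intros x Hx. destruct (Hs x Hx) as [D1 D2].
  assert (Hx' : 0 <= x <= 1) by lra. destruct (HMb x Hx') as [B _].
  specialize (Hb x Hx').
  assert (Hmx : 0 <= 1 - m * x <= 1) by (split; nra).
  assert (Hk : 0 <= K * (1 - m * x) <= K) by (split; nra).
  split; [apply (is_derive_eq _ _ _ _ D1); ring|].
  split; [|split; [lra|split]].
  + auto_derive; [repeat split; eexists; eassumption|].
    rewrite_derive D1. rewrite_derive D2. field. lra.
  + apply Rabs_le_between in B. unfold Rdiv in *. lra.
  + replace (_ + _) with ((D * (- (K * m) - (K * (1 - m * x)) ^ 2)
      + q x * (K * (1 - m * x)) - (r x + lam)) / D) by (field; lra).
    apply Rdiv_le_0_compat; [exact Hb|exact HD].
Qed.

(* With w = z / y the last hypothesis reads w' <= - (w^2 + k^2) / 2, so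
   atan (w / k) decreases at rate at least k / 2. *)
Lemma riccati_blowup (y z dz : R -> R) (a b k : R) :
  0 < k -> a < b -> continuity y -> continuity z ->
  (forall x, a <= x <= b -> 0 < y x) ->
  (forall x, a < x < b ->
    is_derive y x (z x) /\ is_derive z x (dz x) /\
    dz x * y x - z x ^ 2 <= - (z x ^ 2 + k ^ 2 * y x ^ 2) / 2) ->
  k / 2 * (b - a) < PI.
Proof.
intros Hk Hab Hy Hz Hpos Hs.
set (f := fun x => - atan (z x / (k * y x)) - k / 2 * x).
assert (Hf : f a <= f b).
{ apply (nondecreasing_on f (fun x =>
    k * - (dz x * y x - z x ^ 2 + (z x ^ 2 + k ^ 2 * y x ^ 2) / 2)
      / (z x ^ 2 + k ^ 2 * y x ^ 2))); [lra| | |]; intros x Hx.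
  - assert (P : 0 < k * y x) by (apply Rmult_lt_0_compat; [exact Hk|now apply Hpos]).
    apply (continuity_pt_minus (fun x => - atan (z x / (k * y x)))); [|reg].
    apply (continuity_pt_opp (fun x => atan (z x / (k * y x)))).
    apply (continuity_pt_comp (fun x => z x / (k * y x)) atan); [reg; lra|].
    apply derivable_continuous_pt, derivable_pt_atan.
  - destruct (Hs x Hx) as [D1 [D2 _]].
    assert (P : 0 < y x) by (apply Hpos; lra).
    assert (P1 : 0 < k * y x) by (apply Rmult_lt_0_compat; assumption).
    pose proof (pow2_ge_0 (z x)). assert (P2 : 0 < k ^ 2 * y x ^ 2)
      by (apply Rmult_lt_0_compat; apply pow_lt; assumption).
    unfold f. auto_derive.
    + repeat split; try (eexists; eassumption). lra.
    + rewrite_derive D1. rewrite_derive D2. field.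
      rewrite Rpow_mult_distr. repeat split; lra.
  - destruct (Hs x Hx) as [_ [_ Hd]].
    assert (P : 0 < y x) by (apply Hpos; lra).
    pose proof (pow2_ge_0 (z x)). assert (P2 : 0 < k ^ 2 * y x ^ 2)
      by (apply Rmult_lt_0_compat; apply pow_lt; assumption).
    apply Rdiv_le_0_compat; [|lra]. apply Rmult_le_pos; lra. }
unfold f in Hf.
pose proof (atan_bound (z a / (k * y a))). pose proof (atan_bound (z b / (k * y b))).
lra.
Qed.

(** * Existence of the least eigenvalue *)

Lemma bc_value_continuous_dependence (D : R) (q r : R -> R)
    (bc : boundary_condition) (lam : R) (y z : R -> R) :
  0 < D -> continuity q -> continuity r -> initial_solution D q r lam y z ->
  forall e, 0 < e -> exists d, 0 < d /\
    forall mu u v, Rabs (mu - lam) < d -> initial_solution D q r mu u v ->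
    (forall x, 0 <= x <= 1 -> Rabs (u x - y x) < e) /\
    Rabs (bc_value D q bc u v - bc_value D q bc y z) < e.
Proof.
intros HD Hq Hr Hyz e He.
set (C := 1 + Rabs (q 1 / D)). pose proof (Rabs_pos (q 1 / D)) as Hp.
assert (HC : 1 <= C) by (unfold C; lra).
assert (HeC : 0 < e / C) by (apply Rdiv_lt_0_compat; lra).
assert (HeC' : e / C <= e) by (apply Rle_div_l; nra).
assert (HeCC : e / C + Rabs (q 1 / D) * (e / C) = e) by (unfold C in *; field; lra).
destruct (initial_solution_continuous_dependence D q r lam y z HD Hq Hr Hyz _ HeC)
  as [d [Hd Hc]].
exists d. split; [exact Hd|]. intros mu u v Hmu Huv.
specialize (Hc mu u v Hmu Huv). split.
- intros x Hx. destruct (Hc x Hx). lra.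
- destruct (Hc 1) as [H1 H2]; [lra|]. destruct bc; simpl; [lra| |lra].
  replace (v 1 + q 1 / D * u 1 - (z 1 + q 1 / D * y 1)) with
    ((v 1 - z 1) + q 1 / D * (u 1 - y 1)) by ring.
  eapply Rle_lt_trans; [apply Rabs_triang|]. rewrite Rabs_mult. nra.
Qed.

(* This holds exactly for the parameters below the least eigenvalue. *)
Definition positive_below (D : R) (q r : R -> R) (bc : boundary_condition)
    (lam : R) : Prop :=
  exists y z, initial_solution D q r lam y z /\
    (forall x, 0 <= x <= 1 -> 0 < y x) /\ 0 < bc_value D q bc y z.

(** By compactness [y] has a positive minimum, so a small change of parameter preserves both strict
    inequalities. *)
Lemma positive_below_open (D : R) (q r : R -> R) (bc : boundary_condition) (lam : R) :
  0 < D -> continuity q -> continuity r -> positive_below D q r bc lam ->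
  exists d, 0 < d /\
    forall mu, Rabs (mu - lam) < d -> positive_below D q r bc mu.
Proof.
intros HD Hq Hr (y & z & Hyz & Hpos & Hb).
destruct (continuity_ab_min y 0 1) as [m [Hm Im]]; [lra|intros; apply Hyz|].
destruct (bc_value_continuous_dependence D q r bc lam y z HD Hq Hr Hyz
  (Rmin (y m) (bc_value D q bc y z))) as [d [Hd Hc]].
{ apply Rmin_glb_lt; [now apply Hpos|exact Hb]. }
exists d. split; [exact Hd|]. intros mu Hmu.
destruct (initial_solution_exists D q r mu HD Hq Hr) as [u [v [Huv _]]].
exists u, v. split; [exact Huv|]. destruct (Hc mu u v Hmu Huv) as [H1 H2].
pose proof (Rmin_l (y m) (bc_value D q bc y z)).
pose proof (Rmin_r (y m) (bc_value D q bc y z)).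
apply Rabs_def2 in H2. split; [|lra].
intros x Hx. specialize (H1 x Hx). apply Rabs_def2 in H1. specialize (Hm x Hx). lra.
Qed.

(** The barrier 1 - x costs at most 2D, which explains -B - 2D. It vanishes at 1, so y and y' are
    both positive there, and every boundary functional is positive. *)
Lemma positive_below_small (D : R) (q r : R -> R) (bc : boundary_condition) :
  0 < D -> continuity q -> continuity r ->
  (forall x, 0 <= x <= 1 -> 0 <= q x) ->
  exists lam0, forall lam, lam <= lam0 -> positive_below D q r bc lam.
Proof.
intros HD Hq Hr Hq0. destruct (bounded_on_I01 r Hr) as [B [HB Hrb]].
exists (- B - 2 * D). intros lam Hlam.
destruct (initial_solution_exists D q r lam HD Hq Hr) as [y [z [Hyz _]]].
assert (H := barrier_positivity D q r lam 1 1 y z HD Hq Hr Hyz Rlt_0_1).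
assert (Hp : forall x, 0 <= x <= 1 -> 0 < y x /\ 0 < z x + 1 * (1 - 1 * x) * y x).
{ apply H; [lra|]. intros x Hx. specialize (Hq0 x Hx). specialize (Hrb x Hx).
  apply Rabs_le_between in Hrb.
  assert (0 <= q x * (1 - x)) by (apply Rmult_le_pos; lra).
  assert ((1 - x) ^ 2 <= 1) by nra. nra. }
exists y, z. split; [exact Hyz|]. split; [intros x Hx; now apply Hp|].
destruct (Hp 1) as [H1 H2]; [lra|].
replace (1 - 1 * 1) with 0 in H2 by ring. rewrite Rmult_0_r, Rmult_0_l, Rplus_0_r in H2.
destruct bc; simpl; try assumption.
assert (0 <= q 1 / D) by (apply Rdiv_le_0_compat; [apply Hq0; lra|exact HD]). nra.
Qed.

Lemma positive_below_bounded (D : R) (q r : R -> R) (bc : boundary_condition) :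
  0 < D -> continuity q -> continuity r ->
  exists lam1, forall lam, lam1 < lam -> ~ positive_below D q r bc lam.
Proof.
intros HD Hq Hr. destruct (bounded_on_I01 r Hr) as [B [HB Hrb]].
destruct (bounded_on_I01 (fun x => q x / D)) as [M [HM Hqb]]; [reg|].
(* Riccati blow-up on [0,1] with k = 9 would give 9/2 < PI, although PI <= 4. The summand M^2/2 pays
   for the transport term after completing the square. *)
exists (B + D * (9 ^ 2 / 2 + M ^ 2 / 2)).
intros lam Hlam (y & z & [Hy [Hz [_ [_ Hs]]]] & Hpos & _).
assert (H : 9 / 2 * (1 - 0) < PI).
{ apply (riccati_blowup y z (fun x => - (q x * z x + (r x + lam) * y x) / D));
    [lra|lra|exact Hy|exact Hz|exact Hpos|].
  intros x Hx. destruct (Hs x Hx) as [D1 D2]. split; [exact D1|split; [exact D2|]].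
  assert (Hx' : 0 <= x <= 1) by lra.
  specialize (Hrb x Hx'). specialize (Hqb x Hx').
  apply Rabs_le_between in Hrb. apply Rabs_le_between in Hqb.
  assert (H1 : 9 ^ 2 / 2 + M ^ 2 / 2 <= (r x + lam) / D) by (apply Rle_div_r; lra).
  replace (- (q x * z x + (r x + lam) * y x) / D * y x) with
    (- (q x / D) * z x * y x - (r x + lam) / D * y x ^ 2) by (field; lra).
  assert (H2 : (q x / D) ^ 2 <= M ^ 2) by nra.
  pose proof (pow2_ge_0 (z x + q x / D * y x)). pose proof (pow2_ge_0 (y x)).
  assert ((9 ^ 2 / 2 + M ^ 2 / 2) * y x ^ 2 <= (r x + lam) / D * y x ^ 2)
    by (apply Rmult_le_compat_r; assumption).
  assert ((q x / D) ^ 2 * y x ^ 2 <= M ^ 2 * y x ^ 2)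
    by (apply Rmult_le_compat_r; assumption).
  lra. }
pose proof PI_4. lra.
Qed.

(** An interior zero would be a minimum, hence a double zero, which is excluded. At a zero at 1 the
    slope is nonzero, and a positive slope would force [y] to be nonpositive just before 1. *)
Lemma nonnegative_solution_positive (D : R) (q r : R -> R) (lam : R) (y z : R -> R) :
  0 < D -> continuity q -> continuity r -> initial_solution D q r lam y z ->
  (forall x, 0 <= x <= 1 -> 0 <= y x) ->
  (forall x, 0 <= x < 1 -> 0 < y x) /\ (y 1 = 0 -> z 1 < 0).
Proof.
intros HD Hq Hr Hyz Hnn.
assert (Hnd := initial_solution_nondegenerate D q r lam y z HD Hq Hr Hyz).
destruct Hyz as [Hy [Hz [Hy0 [_ Hs]]]].
assert (Hpos : forall x, 0 <= x < 1 -> 0 < y x).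
{ intros x Hx. destruct (Hnn x) as [P|E]; [lra|exact P|exfalso]. symmetry in E.
  assert (Hx0 : 0 < x).
  { destruct (proj1 Hx) as [P|P]; [exact P|]. rewrite <- P in E. lra. }
  destruct (Hs x) as [D1 _]; [lra|]. apply is_derive_Reals in D1.
  apply (Hnd x); [lra|exact E|].
  rewrite <- (deriv_minimum y 0 1 x (exist _ (z x) D1)); [reflexivity|lra|lra|].
  intros t Ht1 Ht2. rewrite E. apply Hnn. lra. }
split; [exact Hpos|]. intros E. apply Rnot_le_lt. intros Hz1.
assert (Hz1' : 0 < z 1).
{ destruct Hz1 as [P|P]; [exact P|]. exfalso. apply (Hnd 1); [lra|exact E|auto]. }
destruct (Hz 1 (z 1) Hz1') as [d [Hd Hc]].
set (t := Rmax 0 (1 - d / 2)).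
assert (Ht : 0 <= t < 1) by (split; [apply Rmax_l|apply Rmax_lub_lt; lra]).
assert (Ht' : 1 - d / 2 <= t) by apply Rmax_r.
assert (y t <= y 1); [|specialize (Hpos t Ht); lra].
apply (nondecreasing_on y z); [lra|intros; apply Hy| |].
- intros x Hx. apply Hs. lra.
- intros x Hx. assert (Hdist : Rabs (z x - z 1) < z 1).
  { apply Hc. split; [split; [exact I|lra]|].
    simpl. unfold Rdist. rewrite Rabs_minus_sym, Rabs_pos_eq; lra. }
  apply Rabs_def2 in Hdist. lra.
Qed.

Lemma positive_below_not_eigenvalue (D : R) (q r : R -> R)
    (bc : boundary_condition) (lam : R) :
  0 < D -> continuity q -> continuity r ->
  positive_below D q r bc lam -> ~ is_eigenvalue D q r bc lam.
Proof.
intros HD Hq Hr (y & z & Hyz & _ & Hb) He.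
apply (is_eigenvalue_iff D q r bc lam y z HD Hq Hr Hyz) in He. lra.
Qed.

(** At the supremum of [E] the solution and its functional are limits of positive quantities, hence
    nonnegative; a positive functional would put the supremum itself in the open set
    [positive_below]. No parameter below is an eigenvalue. *)
Lemma least_eigenvalue_exists (D : R) (q r : R -> R) (bc : boundary_condition) :
  0 < D -> continuity q -> continuity r ->
  (forall x, 0 <= x <= 1 -> 0 <= q x) ->
  exists lam y z, is_least (is_eigenvalue D q r bc) lam /\
    initial_solution D q r lam y z /\ bc_value D q bc y z = 0 /\
    (forall x, 0 <= x < 1 -> 0 < y x) /\ (0 < y 1 \/ z 1 < 0).
Proof.
intros HD Hq Hr Hq0.
set (E := fun lam => forall mu, mu <= lam -> positive_below D q r bc mu).
destruct (positive_below_small D q r bc HD Hq Hr Hq0) as [lam0 H0].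
destruct (positive_below_bounded D q r bc HD Hq Hr) as [lam1 H1].
destruct (completeness E) as [lam [Hub Hlub]].
{ exists lam1. intros l Hl. apply Rnot_lt_le. intros Hlt.
  apply (H1 l Hlt), Hl, Rle_refl. }
{ exists lam0. exact H0. }
assert (Hlt : forall mu, mu < lam -> positive_below D q r bc mu).
{ intros mu Hmu. destruct (classic (positive_below D q r bc mu)) as [P|N]; [exact P|].
  exfalso. enough (lam <= mu) by lra. apply Hlub. intros l Hl.
  apply Rnot_lt_le. intros Hml. apply N, Hl. lra. }
assert (Hself : ~ positive_below D q r bc lam).
{ intros P. destruct (positive_below_open D q r bc lam HD Hq Hr P) as [d [Hd Ho]].
  enough (lam + d / 2 <= lam) by lra. apply Hub. intros mu Hmu.
  destruct (Rlt_le_dec mu lam) as [L|L]; [now apply Hlt|].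
  apply Ho. rewrite Rabs_pos_eq; lra. }
destruct (initial_solution_exists D q r lam HD Hq Hr) as [y [z [Hyz _]]].
assert (Hap : forall e, 0 < e ->
  (forall x, 0 <= x <= 1 -> - e <= y x) /\ - e <= bc_value D q bc y z).
{ intros e He.
  destruct (bc_value_continuous_dependence D q r bc lam y z HD Hq Hr Hyz e He)
    as [d [Hd Hc]].
  destruct (Hlt (lam - d / 2)) as (u & v & Huv & Hpos & Hb); [lra|].
  destruct (Hc (lam - d / 2) u v) with (2 := Huv) as [C1 C2].
  { replace (lam - d / 2 - lam) with (- (d / 2)) by ring.
    rewrite Rabs_Ropp, Rabs_pos_eq; lra. }
  apply Rabs_def2 in C2. split; [|lra]. intros x Hx.
  specialize (C1 x Hx). specialize (Hpos x Hx). apply Rabs_def2 in C1. lra. }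
assert (Hge : forall t, (forall e, 0 < e -> - e <= t) -> 0 <= t).
{ intros t Ht. apply Rnot_lt_le. intros Hn. specialize (Ht (- t / 2)). lra. }
assert (Hnn : forall x, 0 <= x <= 1 -> 0 <= y x).
{ intros x Hx. apply Hge. intros e He. now apply (Hap e He). }
destruct (nonnegative_solution_positive D q r lam y z HD Hq Hr Hyz Hnn) as [Hpos Hend].
assert (Hend' : 0 < y 1 \/ z 1 < 0).
{ destruct (Hnn 1) as [P|P]; [lra|now left|right; auto]. }
assert (Hb : bc_value D q bc y z = 0).
{ destruct (Hge (bc_value D q bc y z)) as [P|P]; [intros e He; now apply Hap| |auto].
  exfalso. apply Hself. exists y, z. split; [exact Hyz|]. split; [|exact P].
  intros x Hx. destruct (Rlt_le_dec x 1) as [L|L]; [apply Hpos; lra|].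
  replace x with 1 by lra.
  (* If y(1) = 0 then z(1) < 0, and under each of the three conditions the functional could not be
     positive. *)
  destruct (Hnn 1) as [P1|P1]; [lra|exact P1|]. symmetry in P1. specialize (Hend P1).
  destruct bc; simpl in P; rewrite ?P1 in P; lra. }
exists lam, y, z. split; [|auto]. split.
- now apply (is_eigenvalue_iff D q r bc lam y z).
- intros mu Hmu. apply Rnot_lt_le. intros L.
  apply (positive_below_not_eigenvalue D q r bc mu HD Hq Hr); auto.
Qed.

(** * Small-diffusion limits *)

Lemma is_least_unique (E : R -> Prop) (m n : R) : is_least E m -> is_least E n -> m = n.
Proof. intros [Em Hm] [En Hn]. apply Rle_antisym; auto. Qed.

Lemma least_eq (E : R -> Prop) (m : R) : is_least E m -> least E = m.
Proof.
intros Hm. apply (is_least_unique E); [|exact Hm].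
unfold least. apply epsilon_spec. now exists m.
Qed.

(** Compactness provides a least value, so [min_on] is not the unspecified default of [least]. *)
Lemma min_on_attained (r : R -> R) (a b : R) :
  C0_01 r -> 0 <= a -> a <= b -> b <= 1 ->
  exists x, a <= x <= b /\ min_on a b (fun x => - r x) = - r x /\
    forall t, a <= t <= b -> - r x <= - r t.
Proof.
intros Hr Ha Hab Hb. apply C0_01_clamp in Hr.
destruct (continuity_ab_min (fun x => - r (clamp x)) a b Hab) as [x [Hx Ix]].
{ intros c _. exact (continuity_pt_opp _ c (Hr c)). }
assert (H : forall t, a <= t <= b -> - r x <= - r t).
{ intros t It. specialize (Hx t It). rewrite !clamp_id in Hx by lra. exact Hx. }
exists x. split; [exact Ix|]. split; [|exact H].
apply least_eq. split; [now exists x|]. now intros y [t [It ->]]; apply H.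
Qed.

(** Existence of the least eigenvalue identifies the value chosen by [least] and supplies its
    positive eigenfunction. *)
Lemma principal_eigenvalue_spec (D : R) (q r : R -> R) (bc : boundary_condition) :
  0 < D -> C0_01 q -> C0_01 r -> (forall x, 0 <= x <= 1 -> 0 <= q x) ->
  exists y z,
    initial_solution D (fun x => q (clamp x)) (fun x => r (clamp x))
      (principal_eigenvalue q r bc D) y z /\
    bc_value D q bc y z = 0 /\
    (forall x, 0 <= x < 1 -> 0 < y x) /\ (0 < y 1 \/ z 1 < 0).
Proof.
intros HD Hq Hr Hq0. apply C0_01_clamp in Hq, Hr.
destruct (least_eigenvalue_exists D _ _ bc HD Hq Hr)
  as (lam & y & z & [Hl1 Hl2] & Hyz & Hb & Hpos).
{ intros x _. apply Hq0, clamp_I01. }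
exists y, z. unfold principal_eigenvalue. rewrite (least_eq _ lam).
- split; [exact Hyz|]. split; [|exact Hpos].
  unfold bc_value in *. rewrite (clamp_id 1) in Hb by lra. exact Hb.
- split; [now apply is_eigenvalue_clamp|].
  intros mu Hmu. apply Hl2. now apply (is_eigenvalue_clamp D q r bc mu).
Qed.

(** The maximum of [q] and [f] is positive at every point, hence bounded below by a positive
    constant. [K] becomes the height of the barrier. *)
Lemma combination_bounded_below (q f : R -> R) :
  continuity q -> continuity f ->
  (forall x, 0 <= x <= 1 -> 0 <= q x) ->
  (forall x, 0 <= x <= 1 -> q x = 0 -> 0 < f x) ->
  exists K eta, 0 < K /\ 0 < eta /\
    forall x, 0 <= x <= 1 -> eta <= K * q x + f x.
Proof.
intros Hq Hf Hq0 Hqf.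
destruct (bounded_on_I01 f Hf) as [B [HB Hfb]].
destruct (continuity_ab_min (fun x => (q x + f x + Rabs (q x - f x)) / 2) 0 1)
  as [m [Hm Im]]; [lra|intros; reg|].
assert (Hmax : forall x, (q x + f x + Rabs (q x - f x)) / 2 = Rmax (q x) (f x)).
{ intros x. unfold Rmax, Rabs. destruct Rle_dec, Rcase_abs; lra. }
(* Where q < mu, f >= mu; elsewhere K q absorbs the lower bound - B of f. *)
set (mu := Rmax (q m) (f m)).
assert (Hmu : 0 < mu).
{ unfold mu. specialize (Hq0 m Im). specialize (Hqf m Im).
  destruct Hq0 as [P|P].
  - eapply Rlt_le_trans; [exact P|apply Rmax_l].
  - eapply Rlt_le_trans; [apply Hqf; auto|apply Rmax_r]. }
exists ((B + mu) / mu), mu.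
split; [apply Rdiv_lt_0_compat; lra|]. split; [exact Hmu|].
intros x Hx. specialize (Hm x Hx). simpl in Hm. rewrite !Hmax in Hm. fold mu in Hm.
specialize (Hfb x Hx). apply Rabs_le_between in Hfb. specialize (Hq0 x Hx).
assert (HK : 0 < (B + mu) / mu) by (apply Rdiv_lt_0_compat; lra).
unfold Rmax in Hm. destruct Rle_dec.
- assert (0 <= (B + mu) / mu * q x) by (apply Rmult_le_pos; lra). lra.
- assert ((B + mu) / mu * mu <= (B + mu) / mu * q x)
    by (apply Rmult_le_compat_l; lra).
  replace ((B + mu) / mu * mu) with (B + mu) in * by (field; lra). lra.
Qed.

Lemma principal_eigenvalue_lower_bound (q r : R -> R) (bc : boundary_condition)
    (L e : R) :
  C0_01 q -> C0_01 r -> (forall x, 0 <= x <= 1 -> 0 <= q x) ->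
  (forall x, 0 <= x <= 1 -> q x = 0 -> L <= - r x) ->
  (L <= - r 1 \/ bc = NF_H \/ (bc = NF_FF /\ 0 < q 1)) -> 0 < e ->
  exists d, 0 < d /\
    forall D, 0 < D < d -> L - e < principal_eigenvalue q r bc D.
Proof.
intros Hq Hr Hq0 HL Hbc He.
assert (Hqc := C0_01_clamp q Hq). assert (Hrc := C0_01_clamp r Hr).
(* The slope of the barrier K (1 - m x): [m] = 1 makes it vanish at 1 and serves every boundary
   condition but needs [L <= - r 1]; [m] = 0 is the constant barrier. *)
assert (Hm : exists m, (m = 1 /\ L <= - r 1) \/
  (m = 0 /\ (bc = NF_H \/ (bc = NF_FF /\ 0 < q 1)))).
{ destruct Hbc; [exists 1|exists 0]; auto. }
destruct Hm as [m Hm].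
assert (Hm01 : 0 <= m <= 1) by (destruct Hm; lra).
destruct (combination_bounded_below (fun x => q (clamp x) * (1 - m * x))
  (fun x => - r (clamp x) - L + e)) as (K & eta & HK & Heta & Hcomb).
{ apply (continuity_mult (fun x => q (clamp x)) (fun x => 1 - m * x));
    [exact Hqc|reg]. }
{ set (rc := fun x => r (clamp x)) in *.
  change (continuity (fun x => - rc x - L + e)). clearbody rc. reg. }
{ intros x Hx. apply Rmult_le_pos; [apply Hq0, clamp_I01|nra]. }
{ intros x Hx. rewrite clamp_id by exact Hx. intros E.
  apply Rmult_integral in E as [E|E]; [specialize (HL x Hx E); lra|].
  destruct Hm as [[-> H1]|[-> _]]; [|lra]. replace x with 1 by lra. lra. }
(* D (K + K^2) bounds the loss from D (k' - k^2); it has to stay below [eta]. *)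
assert (HKK : 0 < K + K ^ 2) by nra.
(* The constant barrier yields z(1) + K y(1) > 0, which contradicts NF/FF once K < q(1)/D, that is
   for D < q(1)/K. In the other cases the bound 1 is arbitrary. *)
assert (Hd2 : exists d2, 0 < d2 /\
  (m = 0 -> bc = NF_FF -> forall D, 0 < D < d2 -> K < q 1 / D)).
{ destruct (classic (bc = NF_FF /\ 0 < q 1)) as [[_ P]|N].
  - exists (q 1 / K). split; [now apply Rdiv_lt_0_compat|].
    intros _ _ D HD. apply Rlt_div_r; [lra|].
    rewrite Rmult_comm. apply Rlt_div_r; lra.
  - exists 1. split; [lra|]. intros Em Eb. exfalso.
    destruct Hm as [[E _]|[_ [E|E]]]; [lra|congruence|now apply N]. }
destruct Hd2 as [d2 [Hd2 HKd]].
exists (Rmin (eta / (K + K ^ 2)) d2). split.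
{ apply Rmin_glb_lt; [now apply Rdiv_lt_0_compat|exact Hd2]. }
intros D [HD HDd].
assert (HD1 : D * (K + K ^ 2) < eta).
{ apply Rlt_div_r; [exact HKK|]. eapply Rlt_le_trans; [exact HDd|apply Rmin_l]. }
assert (HD2 : D < d2) by (eapply Rlt_le_trans; [exact HDd|apply Rmin_r]).
destruct (principal_eigenvalue_spec D q r bc HD Hq Hr Hq0) as (y & z & Hyz & Hb & _ & _).
set (lam := principal_eigenvalue q r bc D) in *.
apply Rnot_le_lt. intros Hlam.
destruct (barrier_positivity D _ _ lam K m y z HD Hqc Hrc Hyz HK Hm01) with (x := 1)
  as [Y1 Z1]; [|lra|].
{ intros x Hx. specialize (Hcomb x Hx). simpl in Hcomb.
  assert (Hmx : 0 <= 1 - m * x <= 1) by (split; nra).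
  assert ((K * (1 - m * x)) ^ 2 <= K ^ 2).
  { apply pow_incr. split; nra. }
  assert (K * m <= K) by nra.
  assert (D * (- (K + K ^ 2)) <= D * (- (K * m) - (K * (1 - m * x)) ^ 2))
    by (apply Rmult_le_compat_l; lra).
  lra. }
assert (Hq1 : 0 <= q 1 / D) by (apply Rdiv_le_0_compat; [apply Hq0; lra|exact HD]).
assert (Hq1y : 0 <= q 1 / D * y 1) by (apply Rmult_le_pos; lra).
destruct Hm as [[-> _]|[-> Hm]].
- destruct bc; simpl in Hb; lra.
- destruct Hm as [->|[-> P]]; simpl in Hb; [lra|].
  specialize (HKd eq_refl eq_refl D (conj HD HD2)). nra.
Qed.

(** The transport term has the favourable sign and may be dropped, while (r + lam)/D >= c/D >=
    k^2/2; this is the inequality required by [riccati_blowup]. *)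
Lemma positive_solution_interval (D : R) (q r : R -> R) (lam : R) (y z : R -> R)
    (a b c k : R) :
  0 < D -> 0 <= a -> a < b -> b <= 1 -> 0 < k -> k ^ 2 * D <= 2 * c ->
  initial_solution D q r lam y z ->
  (forall x, a <= x <= b -> 0 < y x) ->
  (forall x, a < x < b -> 0 <= q x * z x /\ c <= r x + lam) ->
  k / 2 * (b - a) < PI.
Proof.
intros HD Ha Hab Hb Hk Hkc [Hy [Hz [_ [_ Hs]]]] Hpos Hc.
apply (riccati_blowup y z (fun x => - (q x * z x + (r x + lam) * y x) / D));
  try assumption.
intros x Hx. destruct (Hs x) as [D1 D2]; [lra|].
split; [exact D1|]. split; [exact D2|].
destruct (Hc x Hx) as [C1 C2].
assert (P : 0 < y x) by (apply Hpos; lra).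
assert (P2 : 0 < y x ^ 2) by now apply pow_lt.
assert (H1 : k ^ 2 / 2 <= (r x + lam) / D).
{ apply (Rle_div_r (k ^ 2 / 2)); lra. }
assert (H2 : 0 <= q x * z x / D * y x)
  by (apply Rmult_le_pos; [apply Rdiv_le_0_compat|]; lra).
assert (H3 : k ^ 2 / 2 * y x ^ 2 <= (r x + lam) / D * y x ^ 2)
  by (apply Rmult_le_compat_r; lra).
pose proof (pow2_ge_0 (z x)).
replace (- (q x * z x + (r x + lam) * y x) / D * y x) with
  (- (q x * z x / D * y x) - (r x + lam) / D * y x ^ 2) by (field; lra).
lra.
Qed.

Lemma principal_eigenvalue_upper_bound_zero_set (q r : R -> R)
    (bc : boundary_condition) (a b x0 e : R) :
  C0_01 q -> C0_01 r -> (forall x, 0 <= x <= 1 -> 0 <= q x) ->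
  0 <= a -> a < b -> b <= 1 -> (forall x, a <= x <= b -> q x = 0) ->
  a <= x0 <= b -> 0 < e ->
  exists d, 0 < d /\
    forall D, 0 < D < d -> principal_eigenvalue q r bc D < - r x0 + e.
Proof.
intros Hq Hr Hq0 Ha Hab Hb Hqz Hx0 He.
assert (He2 : 0 < e / 2) by lra.
destruct (C0_01_clamp r Hr x0 (e / 2) He2) as [d [Hd Hc]].
set (a' := Rmax a (x0 - d / 2)). set (b1 := Rmin b (x0 + d / 2)).
assert (Hab1 : a' < b1) by (unfold a', b1; apply Rmax_lub_lt; apply Rmin_glb_lt; lra).
pose proof (Rmax_l a (x0 - d / 2)) as A1. pose proof (Rmax_r a (x0 - d / 2)) as A2.
pose proof (Rmin_l b (x0 + d / 2)) as B1. pose proof (Rmin_r b (x0 + d / 2)) as B2.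
fold a' in A1, A2. fold b1 in B1, B2.
(* Stopping at the midpoint keeps the interval away from 1, where the eigenfunction may vanish. *)
set (b' := (a' + b1) / 2). assert (Hab' : a' < b' < b1) by (unfold b'; lra).
(* With this [k] the blow-up estimate reads 4 < PI, which is false; D < e/k^2 then gives k^2 D <= 2c
   for c = e/2. *)
set (k := 8 / (b' - a')).
assert (Hk : 0 < k) by (apply Rdiv_lt_0_compat; lra).
assert (Hk2 : 0 < k ^ 2) by now apply pow_lt.
exists (e / k ^ 2). split; [now apply Rdiv_lt_0_compat|].
intros D [HD HDd]. apply Rlt_div_r in HDd; [|exact Hk2].
destruct (principal_eigenvalue_spec D q r bc HD Hq Hr Hq0)
  as (y & z & Hyz & _ & Hpos & _).
apply Rnot_le_lt. intros Hlam.
assert (H : k / 2 * (b' - a') < PI).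
{ apply (positive_solution_interval D _ _ _ y z a' b' (e / 2) k HD) with (6 := Hyz);
    try lra.
  - intros x Hx. apply Hpos. lra.
  - intros x Hx. split.
    + rewrite clamp_id by lra. rewrite Hqz by lra. lra.
    + destruct (Req_dec x0 x) as [<-|Hn].
      { rewrite clamp_id by lra. lra. }
      assert (Hdist : Rabs (r (clamp x) - r (clamp x0)) < e / 2).
      { apply Hc. split; [split; [exact I|exact Hn]|]. simpl. unfold Rdist.
        apply Rabs_def1; lra. }
      rewrite (clamp_id x0) in Hdist by lra. apply Rabs_def2 in Hdist. lra. }
replace (k / 2 * (b' - a')) with 4 in H by (unfold k; field; lra).
pose proof PI_4. lra.
Qed.

(** If the eigenvalue were at least -r(1) + e, the eigenfunction would be nondecreasing near 1
    because z(1) = 0. Then q z >= 0 there without any vanishing of [q], and blow-up on an interval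
    ending at 1 is contradictory. *)
Lemma principal_eigenvalue_upper_bound_endpoint (q r : R -> R) (e : R) :
  C0_01 q -> C0_01 r -> (forall x, 0 <= x <= 1 -> 0 <= q x) -> 0 < e ->
  exists d, 0 < d /\
    forall D, 0 < D < d -> principal_eigenvalue q r NF_NF D < - r 1 + e.
Proof.
intros Hq Hr Hq0 He.
assert (Hqc := C0_01_clamp q Hq). assert (Hrc := C0_01_clamp r Hr).
assert (He2 : 0 < e / 2) by lra.
destruct (Hrc 1 (e / 2) He2) as [d [Hd Hc]].
set (a := Rmax 0 (1 - d / 2)).
assert (Ha : 0 <= a < 1) by (split; [apply Rmax_l|apply Rmax_lub_lt; lra]).
assert (Ha' : 1 - d / 2 <= a) by apply Rmax_r.
set (k := 8 / (1 - a)).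
assert (Hk : 0 < k) by (apply Rdiv_lt_0_compat; lra).
assert (Hk2 : 0 < k ^ 2) by now apply pow_lt.
exists (e / k ^ 2). split; [now apply Rdiv_lt_0_compat|].
intros D [HD HDd]. apply Rlt_div_r in HDd; [|exact Hk2].
destruct (principal_eigenvalue_spec D q r NF_NF HD Hq Hr Hq0)
  as (y & z & Hyz & Hb & Hpos & Hend).
simpl in Hb. set (lam := principal_eigenvalue q r NF_NF D) in *.
apply Rnot_le_lt. intros Hlam.
(* Here z(1) = 0 excludes z(1) < 0, so positivity extends to the endpoint. *)
assert (Hpos1 : forall x, 0 <= x <= 1 -> 0 < y x).
{ intros x Hx. destruct (Rlt_le_dec x 1) as [P|P]; [apply Hpos; lra|].
  replace x with 1 by lra. destruct Hend; lra. }
assert (Hrl : forall x, a < x < 1 -> e / 2 <= r (clamp x) + lam).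
{ intros x Hx. assert (Hdist : Rabs (r (clamp x) - r (clamp 1)) < e / 2).
  { apply Hc. split; [split; [exact I|lra]|]. simpl. unfold Rdist.
    apply Rabs_def1; lra. }
  rewrite (clamp_id 1) in Hdist by lra. apply Rabs_def2 in Hdist. lra. }
assert (Hz : forall x, a < x < 1 -> 0 <= z x).
{ (* exp (Q / D) z is nonincreasing, and it vanishes at 1. *)
  intros x Hx. destruct Hyz as [_ [Hzc [_ [_ Hs]]]].
  set (Q := RInt (fun t => q (clamp t)) 0).
  assert (HQ : continuity Q) by now apply continuity_RInt.
  assert (Hm : - (exp (Q x / D) * z x) <= - (exp (Q 1 / D) * z 1)).
  { apply (nondecreasing_on (fun t => - (exp (Q t / D) * z t))
      (fun t => exp (Q t / D) * ((r (clamp t) + lam) * y t / D)));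
      [lra|intros; reg| |]; intros t Ht.
    - destruct (Hs t) as [_ D2]; [lra|].
      assert (D1 : is_derive Q t (q (clamp t)))
        by exact (is_derive_RInt_continuity _ t Hqc).
      clearbody Q. auto_derive; [repeat split; eexists; eassumption|].
      rewrite_derive D1. rewrite_derive D2. fold (Q t / D). field. lra.
    - apply Rmult_le_pos; [left; apply exp_pos|].
      apply Rdiv_le_0_compat; [|exact HD].
      apply Rmult_le_pos; [specialize (Hrl t); lra|].
      left. apply Hpos1. lra. }
  rewrite Hb, Rmult_0_r in Hm. pose proof (exp_pos (Q x / D)). nra. }
assert (H : k / 2 * (1 - a) < PI).
{ apply (positive_solution_interval D _ _ lam y z a 1 (e / 2) k HD) with (6 := Hyz);
    try lra.
  - intros x Hx. apply Hpos1. lra.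
  - intros x Hx. split; [|now apply Hrl].
    apply Rmult_le_pos; [apply Hq0, clamp_I01|now apply Hz]. }
replace (k / 2 * (1 - a)) with 4 in H by (unfold k; field; lra).
pose proof PI_4. lra.
Qed.

(** * From the two bounds to the limits *)

Lemma lim_at_0_right_finite (f : R -> R) (l : R) :
  (forall e, 0 < e -> exists d, 0 < d /\ forall D, 0 < D < d -> l - e < f D) ->
  (forall e, 0 < e -> exists d, 0 < d /\ forall D, 0 < D < d -> f D < l + e) ->
  lim_at_0_right f (Finite l).
Proof.
intros Hlow Hup. unfold lim_at_0_right, Rbar_locally.
apply (filterlim_locally (F := at_right 0) f l). intros e.
destruct (Hlow e (cond_pos e)) as [d1 [Hd1 H1]].
destruct (Hup e (cond_pos e)) as [d2 [Hd2 H2]].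
assert (Hd : 0 < Rmin d1 d2) by now apply Rmin_glb_lt.
exists (mkposreal _ Hd). intros D HDb HD.
apply Rabs_def2 in HDb. unfold minus, plus, opp in HDb; cbn in HDb.
pose proof (Rmin_l d1 d2). pose proof (Rmin_r d1 d2).
assert (D1 : 0 < D < d1) by lra. assert (D2 : 0 < D < d2) by lra.
specialize (H1 D D1). specialize (H2 D D2).
apply Rabs_def1; unfold minus, plus, opp; cbn; lra.
Qed.

Lemma lim_at_0_right_p_infty (f : R -> R) :
  (forall M, exists d, 0 < d /\ forall D, 0 < D < d -> M < f D) ->
  lim_at_0_right f p_infty.
Proof.
intros H P [M HP]. destruct (H M) as [d [Hd Hf]].
exists (mkposreal _ Hd). intros D HDb HD. apply HP, Hf.
apply Rabs_def2 in HDb. unfold minus, plus, opp in HDb; cbn in HDb. lra.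
Qed.

(** If [b] = 1, the value -r(1) takes part in the minimum and the barrier vanishing at 1 is
    admissible for every condition; otherwise the constant barrier is used. *)
Lemma limit_zero_set (q r : R -> R) (bc : boundary_condition) (a b : R) :
  C0_01 q -> C0_01 r -> (forall x, 0 <= x <= 1 -> 0 <= q x) ->
  0 <= a -> a < b -> b <= 1 ->
  (forall x, 0 <= x <= 1 -> q x = 0 <-> a <= x <= b) ->
  (b = 1 \/ bc = NF_H \/ (bc = NF_FF /\ 0 < q 1)) ->
  lim_at_0_right (principal_eigenvalue q r bc)
    (Finite (min_on a b (fun x => - r x))).
Proof.
intros Hq Hr Hq0 Ha Hab Hb Hz Hbc.
destruct (min_on_attained r a b) as [x0 [Ix0 [-> Hmin]]]; try lra; [exact Hr|].
apply lim_at_0_right_finite; intros e He.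
- apply principal_eigenvalue_lower_bound; auto.
  + intros x Hx E. apply Hmin, Hz; assumption.
  + destruct Hbc as [->|Hbc]; [left; apply Hmin; lra|now right].
- apply (principal_eigenvalue_upper_bound_zero_set q r bc a b); auto.
  intros x Hx. apply Hz; lra.
Qed.

(** The barrier vanishing at 1 needs the level to be at most -r(1), hence the extra term. The upper
    bound comes from the zero set or from the endpoint, according to which attains the minimum. *)
Lemma limit_NF_NF (q r : R -> R) (a b : R) :
  C0_01 q -> C0_01 r -> (forall x, 0 <= x <= 1 -> 0 <= q x) ->
  0 <= a -> a < b -> b <= 1 ->
  (forall x, 0 <= x <= 1 -> q x = 0 <-> a <= x <= b) ->
  lim_at_0_right (principal_eigenvalue q r NF_NF)
    (Finite (Rmin (min_on a b (fun x => - r x)) (- r 1))).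
Proof.
intros Hq Hr Hq0 Ha Hab Hb Hz.
destruct (min_on_attained r a b) as [x0 [Ix0 [-> Hmin]]]; try lra; [exact Hr|].
apply lim_at_0_right_finite; intros e He.
- apply principal_eigenvalue_lower_bound; auto.
  + intros x Hx E. eapply Rle_trans; [apply Rmin_l|].
    apply Hmin, Hz; assumption.
  + left. apply Rmin_r.
- unfold Rmin. destruct Rle_dec.
  + apply (principal_eigenvalue_upper_bound_zero_set q r NF_NF a b); auto.
    intros x Hx. apply Hz; lra.
  + now apply principal_eigenvalue_upper_bound_endpoint.
Qed.

Theorem proposition4p2 (r q : R -> R)
    (hr : C0_01 r) (hq : C1_01 q) (hq0 : forall x, 0 <= x <= 1 -> 0 <= q x) :
  (* (1) *)
  ((forall x, 0 <= x <= 1 -> 0 < q x) ->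
     lim_at_0_right (principal_eigenvalue q r NF_NF) (Finite (- r 1)) /\
     lim_at_0_right (principal_eigenvalue q r NF_FF) p_infty /\
     lim_at_0_right (principal_eigenvalue q r NF_H) p_infty) /\
  (* (2) *)
  (forall x0, 0 < x0 < 1 ->
     (forall x, 0 <= x <= x0 -> q x = 0) ->
     (forall x, x0 < x <= 1 -> 0 < q x) ->
     lim_at_0_right (principal_eigenvalue q r NF_NF)
       (Finite (Rmin (min_on 0 x0 (fun x => - r x)) (- r 1))) /\
     lim_at_0_right (principal_eigenvalue q r NF_FF)
       (Finite (min_on 0 x0 (fun x => - r x))) /\
     lim_at_0_right (principal_eigenvalue q r NF_H)
       (Finite (min_on 0 x0 (fun x => - r x)))) /\
  (* (3) *)
  (forall x1 x2, 0 < x1 -> x1 < x2 -> x2 < 1 ->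
     (forall x, x1 <= x <= x2 -> q x = 0) ->
     (forall x, 0 <= x < x1 \/ x2 < x <= 1 -> 0 < q x) ->
     lim_at_0_right (principal_eigenvalue q r NF_NF)
       (Finite (Rmin (- r 1) (min_on x1 x2 (fun x => - r x)))) /\
     lim_at_0_right (principal_eigenvalue q r NF_FF)
       (Finite (min_on x1 x2 (fun x => - r x))) /\
     lim_at_0_right (principal_eigenvalue q r NF_H)
       (Finite (min_on x1 x2 (fun x => - r x)))) /\
  (* (4) *)
  (forall x0, 0 < x0 < 1 ->
     (forall x, x0 <= x <= 1 -> q x = 0) ->
     (forall x, 0 <= x < x0 -> 0 < q x) ->
     lim_at_0_right (principal_eigenvalue q r NF_NF)
       (Finite (min_on x0 1 (fun x => - r x))) /\
     lim_at_0_right (principal_eigenvalue q r NF_FF)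
       (Finite (min_on x0 1 (fun x => - r x))) /\
     lim_at_0_right (principal_eigenvalue q r NF_H)
       (Finite (min_on x0 1 (fun x => - r x)))).
Proof.
assert (Hq : C0_01 q).
{ destruct hq as [dq [Hd _]]. intros x Hx. apply cont_deriv with (1 := Hd x Hx). }
split; [|split; [|split]].
- intros Hpos.
  (* The zero set is empty, so the level [L] of the lower bound is limited only by the boundary
     condition, and not at all under NF/FF and NF/H. *)
  assert (Hne : forall L x, 0 <= x <= 1 -> q x = 0 -> L <= - r x).
  { intros L x Hx E. specialize (Hpos x Hx). lra. }
  assert (H1 : 0 < q 1) by (apply Hpos; lra).
  assert (Hinf : forall bc, (bc = NF_H \/ (bc = NF_FF /\ 0 < q 1)) ->
    lim_at_0_right (principal_eigenvalue q r bc) p_infty).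
  { intros bc Hbc. apply lim_at_0_right_p_infty. intros M.
    destruct (principal_eigenvalue_lower_bound q r bc (M + 1) 1) as [d [Hd H]];
      auto; [lra|].
    exists d. split; [exact Hd|]. intros D HD. specialize (H D HD). lra. }
  split; [|split; apply Hinf; auto].
  apply lim_at_0_right_finite; intros e He.
  + apply principal_eigenvalue_lower_bound; auto. left. lra.
  + now apply principal_eigenvalue_upper_bound_endpoint.
- intros x0 Hx0 Hz Hpos.
  assert (H1 : 0 < q 1) by (apply Hpos; lra).
  assert (Hzero : forall x, 0 <= x <= 1 -> q x = 0 <-> 0 <= x <= x0).
  { intros x Hx. split; [|apply Hz]. intros E. split; [lra|].
    apply Rnot_lt_le. intros L. specialize (Hpos x). lra. }
  split; [|split].
  + apply limit_NF_NF; auto; lra.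
  + apply limit_zero_set; auto; lra.
  + apply limit_zero_set; auto; lra.
- intros x1 x2 Hx1 Hx12 Hx2 Hz Hpos.
  assert (H1 : 0 < q 1) by (apply Hpos; lra).
  assert (Hzero : forall x, 0 <= x <= 1 -> q x = 0 <-> x1 <= x <= x2).
  { intros x Hx. split; [|apply Hz]. intros E.
    split; apply Rnot_lt_le; intros L; specialize (Hpos x); lra. }
  split; [rewrite Rmin_comm|split].
  + apply limit_NF_NF; auto; lra.
  + apply limit_zero_set; auto; lra.
  + apply limit_zero_set; auto; lra.
- intros x0 Hx0 Hz Hpos.
  assert (Hzero : forall x, 0 <= x <= 1 -> q x = 0 <-> x0 <= x <= 1).
  { intros x Hx. split; [|apply Hz]. intros E. split; [|lra].
    apply Rnot_lt_le. intros L. specialize (Hpos x). lra. }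
  (* The zero set reaches 1, so the case [b] = 1 covers all three conditions, NF/NF included. *)
  split; [|split]; apply limit_zero_set; auto; lra.
Qed.
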